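(* (Subject reduction for the language Tores.) 1. If $t[\theta;\sigma]\Downarrow v$, where $\Delta;\cdot;\Gamma\vdash t\Leftarrow T$ or $\Delta;\cdot;\Gamma\vdash t\Rightarrow T$, and $\vdash\theta:\Delta$ and $\sigma:\Gamma[\theta]$, then $v:T[\theta]$. 2. If $g[\theta;\sigma]\cdot\vec N\,v\Downarrow w$, where $g$ is a function value with $\Delta;\cdot;\Gamma\vdash g\Leftarrow(\overrightarrow{u{:}U});S\to T$, and $\vdash\theta:\Delta$, $\sigma:\Gamma[\theta]$, $\vdash\vec N:(\overrightarrow{u{:}U})[\theta]$ and $v:S[\theta,\overrightarrow{N/u}]$, then $w:T[\theta,\overrightarrow{N/u}]$. 3. If $c\cdot_{\mathtt{out}_\nu}\Downarrow w$, where $c:(\nu X{:}K.\,\Lambda\vec u.\,T)\,\vec M$, then $w:T[\overrightarrow{M/u};(\nu X{:}K.\,\Lambda\vec u.\,T)/X]$.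
   Context: INDEX LANGUAGE. Fix an index language with index types $U$, index terms $M,N$ (possibly containing index variables $u$), index contexts $\Delta::=\cdot\mid\Delta,u{:}U$, index substitutions $\Theta::=\cdot\mid\Theta,M/u$, and judgments $\Delta\vdash U\ \mathsf{itype}$, $\Delta\vdash M:U$, $\Delta\vdash M=N$. Index types may depend on index variables; index equality is syntactic equality. There is an index type $\mathsf{nat}$ with constructors $0$ and $\mathsf{suc}\,M$ whose closed inhabitants are exactly the numerals (in the concrete instance $\mathsf{nat}$ is the only index type and terms are $0$, $\mathsf{suc}\,M$, $u$). Substitution typing: $\Delta'\vdash\cdot:\cdot$; and $\Delta'\vdash\Theta,M/u:\Delta,u{:}U$ if $\Delta'\vdash\Theta:\Delta$ and $\Delta'\vdash M:U[\Theta]$. Composition: $(\cdot)[\Theta_2]=\cdot$, $(\Theta_1,M/u)[\Theta_2]=\Theta_1[\Theta_2],M[\Theta_2]/u$. Spines: $\Delta\vdash\cdot:(\cdot)$; and $\Delta\vdash M_0,\vec M:(u_0{:}U_0,\overrightarrow{u{:}U})$ if $\Delta\vdash M_0:U_0$ and $\Delta\vdash\vec M:(\overrightarrow{u{:}U})[M_0/u_0]$; similarly $(u_0{:}U_0,\overrightarrow{u{:}U})$ is an $\mathsf{itype}$ spine in $\Delta$ if $U_0$ is an itype in $\Delta$ and the rest is one in $\Delta,u_0{:}U_0$. An index environment $\theta$ is a closed substitution; $\vdash\theta:\Delta$ means $\cdot\vdash\theta:\Delta$. Unification is a judgment $\Delta\vdash M\doteqdot N\searrow P$ with $P=(\Delta'\mid\Theta)$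 or $P=\#$; matching is a judgment $\Delta_1\vdash\Theta_1\doteq\Theta_2\searrow(\Delta_2\mid\Theta)$ on substitutions (and similarly on terms). Assumed: index typing and equality are decidable; typing and equality are preserved by single and simultaneous substitution; $M[\Theta_1][\Theta_2]=M[\Theta_1[\Theta_2]]$; unification is decidable, $P=(\Delta'\mid\Theta)$ being the most general unifier, unique up to $\alpha$-equivalence (so $\Delta'\vdash\Theta:\Delta$ and $\Delta'\vdash M[\Theta]=N[\Theta]$), and $P=\#$ only if there is no unifier; matching is sound: if $\Delta_1\vdash\Theta_1:\Delta$ and $\Delta_1\vdash\Theta_1\doteq\Theta_2\searrow(\Delta_2\mid\Theta)$ then $\Delta_2\vdash\Theta:\Delta_1$ and $\Delta_2\vdash\Theta_1[\Theta]=\Theta_2$; matching is complete: if $\vdash\theta:\Delta$, $\vdash M[\theta]=N[\theta]$ and $\Delta\vdash M\doteqdot N\searrow(\Delta'\mid\Theta)$ then $\Delta'\vdash\Theta\doteq\theta\searrow(\cdot\mid\theta')$ for some $\theta'$. TYPES. Kinds $K::=*\mid\Pi u{:}U.K$. Types $T::=1\mid T_1\times T_2\mid T_1+T_2\mid(\overrightarrow{u{:}U});T_1\to T_2\mid\Sigma u{:}U.T\mid M=N\mid T\,M\mid\Lambda u.T\mid X\mid\mu X{:}K.T\mid\nu X{:}K.T\mid T_{\mathsf{Rec}}$ with $T_{\mathsf{Rec}}=\mathsf{Rec}_K(0\mapsto T_0\mid\mathsf{suc}\,u,X\mapsto T_s)$. In $(\overrightarrow{u{:}U});T_1\to T_2$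 the $\vec u$ are bound in both $T_1,T_2$. Type variable contexts $\Xi::=\cdot\mid\Xi,X{:}K$; typing contexts $\Gamma::=\cdot\mid\Gamma,x{:}T$. Expressions are taken up to $\alpha$-equivalence. Kind checking $\Delta;\Xi\vdash T\Leftarrow K$: $1\Leftarrow*$; $T_1\times T_2\Leftarrow*$ and $T_1+T_2\Leftarrow *$ if $T_1,T_2\Leftarrow*$; $(\overrightarrow{u{:}U});S\to T\Leftarrow*$ if $(\overrightarrow{u{:}U})$ is an itype spine and $S,T\Leftarrow*$ in $\Delta,\overrightarrow{u{:}U};\Xi$; $\Sigma u{:}U.T\Leftarrow*$ if $U$ is an itype and $T\Leftarrow*$ in $\Delta,u{:}U;\Xi$; $M=N\Leftarrow*$ if $\Delta\vdash M:U$ and $\Delta\vdash N:U$; $\Lambda u.T\Leftarrow\Pi u{:}U.K$ if $T\Leftarrow K$ in $\Delta,u{:}U;\Xi$; $T\Leftarrow*$ if $T\Rightarrow*$. Kind synthesis: $X\Rightarrow K$ if $X{:}K\in\Xi$; $T\,M\Rightarrow K[M/u]$ if $T\Rightarrow\Pi u{:}U.K$ and $\Delta\vdash M:U$; $\mu X{:}K.T\Rightarrow K$ and $\nu X{:}K.T\Rightarrow K$ if $\Delta;\Xi,X{:}K\vdash T\Leftarrow K$; $\mathsf{Rec}_K(0\mapsto T_0\mid\mathsf{suc}\,u,X\mapsto T_s)\Rightarrow K$ if $K=\Pi u{:}\mathsf{nat}.K'$, $\Delta;\Xi\vdash T_0\Leftarrow K'[0/u]$ and $\Delta,u{:}\mathsf{nat};\Xi,X{:}K'\vdash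 T_s\Leftarrow K'[\mathsf{suc}\,u/u]$. An applied lambda $(\Lambda\vec u.T)\,\vec M$ is identified with $T[\overrightarrow{M/u}]$. Typing judgments presuppose that their contexts and types (including annotations) are well-kinded. TERMS. $t,s::=x\mid\langle\rangle\mid\lambda\vec u,x.t\mid t\,\vec M\,s\mid\langle t_1,t_2\rangle\mid\mathtt{split}\,s\,\mathtt{as}\,\langle x_1,x_2\rangle\,\mathtt{in}\,t\mid\mathtt{in}_i\,t\ (i=1,2)\mid(\mathtt{case}\,t\,\mathtt{of}\,\mathtt{in}_1x_1\mapsto t_1\mid\mathtt{in}_2x_2\mapsto t_2)\mid\mathtt{pack}(M,t)\mid\mathtt{unpack}\,t\,\mathtt{as}\,(u,x)\,\mathtt{in}\,s\mid\mathtt{refl}\mid\mathtt{eq}\,s\,\mathtt{with}\,(\Delta.\Theta\mapsto t)\mid\mathtt{eq\_abort}\,s\mid\mathtt{in}_\mu\,t\mid\mathtt{rec}\,f.t\mid\mathtt{corec}\,f.t\mid\mathtt{out}_\nu\,t\mid\mathtt{in}_l\,t\mid\mathtt{out}_l\,t\mid\mathtt{ind}(t_0,\,u,f.\,t_s)\mid t{:}T$, where $l\in\{0,\mathsf{suc}\}$. TYPING (contexts $\Delta;\Xi;\Gamma$ left implicit unless changed; bound variables are fresh for the conclusion). Checking: $\langle\rangle\Leftarrow1$. $\langle t_1,t_2\rangle\Leftarrow T_1\times T_2$ if $t_i\Leftarrow T_i$. $\mathtt{split}\,p\,\mathtt{as}\,\langle x_1,x_2\rangle\,\mathtt{in}\,t\Leftarrow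 T$ if $p\Rightarrow T_1\times T_2$ and $t\Leftarrow T$ with $x_1{:}T_1,x_2{:}T_2$ added to $\Gamma$. $\mathtt{in}_i\,t\Leftarrow T_1+T_2$ if $t\Leftarrow T_i$. The $\mathtt{case}$ term $\Leftarrow S$ if $t\Rightarrow T_1+T_2$ and each $t_i\Leftarrow S$ with $x_i{:}T_i$ added. $\mathtt{pack}(M,t)\Leftarrow\Sigma u{:}U.T$ if $\Delta\vdash M:U$ and $t\Leftarrow T[M/u]$. $\mathtt{unpack}\,t\,\mathtt{as}\,(u,x)\,\mathtt{in}\,s\Leftarrow S$ if $t\Rightarrow\Sigma u{:}U.T$ and $s\Leftarrow S$ in $\Delta,u{:}U;\Xi;\Gamma,x{:}T$. $\mathtt{refl}\Leftarrow M=N$ if $\Delta\vdash M=N$. $\mathtt{eq\_abort}\,s\Leftarrow T$ if $s\Rightarrow M=N$ and $\Delta\vdash M\doteqdot N\searrow\#$. $\mathtt{eq}\,s\,\mathtt{with}\,(\Delta'.\Theta\mapsto t)\Leftarrow T$ if $s\Rightarrow M=N$, $\Delta\vdash M\doteqdot N\searrow(\Delta'\mid\Theta)$ and $\Delta';\Xi[\Theta];\Gamma[\Theta]\vdash t\Leftarrow T[\Theta]$. $\lambda\vec u,x.t\Leftarrow(\overrightarrow{u{:}U});S\to T$ if $t\Leftarrow T$ in $\Delta,\overrightarrow{u{:}U};\Xi;\Gamma,x{:}S$. $\mathtt{in}_\mu\,t\Leftarrow(\mu X{:}K.\Lambda\vec u.T)\,\vec M$ if $t\Leftarrow T[\overrightarrow{M/u};(\mu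 X{:}K.\Lambda\vec u.T)/X]$. $\mathtt{rec}\,f.t\Leftarrow(\overrightarrow{u{:}U});(\mu X{:}K.\Lambda\vec v.S)\,\vec u\to T$ if $\Delta;\Xi,X{:}K;\Gamma,f{:}((\overrightarrow{u{:}U});X\,\vec u\to T)\vdash t\Leftarrow(\overrightarrow{u{:}U});S[\overrightarrow{u/v}]\to T$. $\mathtt{corec}\,f.t\Leftarrow(\overrightarrow{u{:}U});S\to(\nu X{:}K.\Lambda\vec v.T)\,\vec u$ if $\Delta;\Xi,X{:}K;\Gamma,f{:}((\overrightarrow{u{:}U});S\to X\,\vec u)\vdash t\Leftarrow(\overrightarrow{u{:}U});S\to T[\overrightarrow{u/v}]$. (In these two rules $K=\Pi\overrightarrow{v{:}U}.*$ and $X$ does not occur in the conclusion outside its binder, in particular not in $t$.) $\mathtt{ind}(t_0,u,f.t_s)\Leftarrow(u{:}\mathsf{nat});1\to T$ if $t_0\Leftarrow T[0/u]$ and $\Delta,u{:}\mathsf{nat};\Xi;\Gamma,f{:}T\vdash t_s\Leftarrow T[\mathsf{suc}\,u/u]$. $\mathtt{in}_0\,t\Leftarrow T_{\mathsf{Rec}}\,0\,\vec M$ if $t\Leftarrow T_0\,\vec M$. $\mathtt{in}_{\mathsf{suc}}\,t\Leftarrow T_{\mathsf{Rec}}\,(\mathsf{suc}\,N)\,\vec M$ if $t\Leftarrow T_s[N/u;(T_{\mathsf{Rec}}\,N)/X]\,\vec M$. $t\Leftarrow T$ if $t\Rightarrow T$. Synthesis: $x\Rightarrow T$ if $x{:}T\in\Gamma$.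 $t\,\vec M\,s\Rightarrow T[\overrightarrow{M/u}]$ if $t\Rightarrow(\overrightarrow{u{:}U});S\to T$, $\Delta\vdash\vec M:(\overrightarrow{u{:}U})$ and $s\Leftarrow S[\overrightarrow{M/u}]$. $\mathtt{out}_0\,t\Rightarrow T_0\,\vec M$ if $t\Rightarrow T_{\mathsf{Rec}}\,0\,\vec M$. $\mathtt{out}_{\mathsf{suc}}\,t\Rightarrow T_s[N/u;(T_{\mathsf{Rec}}\,N)/X]\,\vec M$ if $t\Rightarrow T_{\mathsf{Rec}}\,(\mathsf{suc}\,N)\,\vec M$. $\mathtt{out}_\nu\,t\Rightarrow T[\overrightarrow{M/u};(\nu X{:}K.\Lambda\vec u.T)/X]$ if $t\Rightarrow(\nu X{:}K.\Lambda\vec u.T)\,\vec M$. $(t{:}T)\Rightarrow T$ if $t\Leftarrow T$. EVALUATION. Term environments $\sigma::=\cdot\mid\sigma,v/x$. Function values $g::=\lambda\vec u,x.t\mid\mathtt{rec}\,f.t\mid\mathtt{corec}\,f.t\mid\mathtt{ind}(t_0,u,f.t_s)$. Closures $c::=g[\theta;\sigma]\mid(\mathtt{corec}\,f.t)[\theta;\sigma]\cdot\vec N\,v$. Values $v::=c\mid\langle\rangle\mid\langle v_1,v_2\rangle\mid\mathtt{in}_i\,v\mid\mathtt{pack}(M,v)\mid\mathtt{refl}\mid\mathtt{in}_\mu\,v\mid\mathtt{in}_l\,v$. Three judgments $t[\theta;\sigma]\Downarrow v$, $c\cdot\vec N\,v\Downarrow w$, $c\cdot_{\mathtt{out}_\nu}\Downarrow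 w$ are defined inductively. (a) $x[\theta;\sigma]\Downarrow\sigma(x)$; $\langle\rangle$ and $\mathtt{refl}$ evaluate to themselves; $g[\theta;\sigma]\Downarrow g[\theta;\sigma]$ (a closure); pairs, $\mathtt{in}_i$, $\mathtt{in}_\mu$, $\mathtt{in}_l$ evaluate componentwise; $\mathtt{pack}(M,t)[\theta;\sigma]\Downarrow\mathtt{pack}(M[\theta],v)$ if $t[\theta;\sigma]\Downarrow v$; $(t{:}T)[\theta;\sigma]\Downarrow v$ if $t[\theta;\sigma]\Downarrow v$; $\mathtt{split}\,t\,\mathtt{as}\,\langle x_1,x_2\rangle\,\mathtt{in}\,s\Downarrow v$ if $t[\theta;\sigma]\Downarrow\langle v_1,v_2\rangle$ and $s[\theta;\sigma,v_1/x_1,v_2/x_2]\Downarrow v$; $\mathtt{case}$ evaluates to $v$ if $t[\theta;\sigma]\Downarrow\mathtt{in}_i\,v'$ and $t_i[\theta;\sigma,v'/x_i]\Downarrow v$; $\mathtt{unpack}\,t\,\mathtt{as}\,(u,x)\,\mathtt{in}\,s$ evaluates to $v$ if $t[\theta;\sigma]\Downarrow\mathtt{pack}(N,v')$ and $s[\theta,N/u;\sigma,v'/x]\Downarrow v$; $(\mathtt{eq}\,s\,\mathtt{with}\,(\Delta.\Theta\mapsto t))[\theta;\sigma]\Downarrow v$ if $s[\theta;\sigma]\Downarrow\mathtt{refl}$, $\Delta\vdash\Theta\doteq\theta\searrow(\cdot\mid\theta')$ and $t[\theta';\sigma]\Downarrow v$; $(\mathtt{out}_l\,t)[\theta;\sigma]\Downarrow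 v$ if $t[\theta;\sigma]\Downarrow\mathtt{in}_l\,v$; $(\mathtt{out}_\nu\,t)[\theta;\sigma]\Downarrow w$ if $t[\theta;\sigma]\Downarrow c$ and $c\cdot_{\mathtt{out}_\nu}\Downarrow w$; $(t\,\vec M\,s)[\theta;\sigma]\Downarrow w$ if $t[\theta;\sigma]\Downarrow c$, $s[\theta;\sigma]\Downarrow v$ and $c\cdot\overrightarrow{M[\theta]}\,v\Downarrow w$. There is no rule for $\mathtt{eq\_abort}$. (b) $(\lambda\vec u,x.t)[\theta;\sigma]\cdot\vec N\,v\Downarrow w$ if $t[\theta,\overrightarrow{N/u};\sigma,v/x]\Downarrow w$; $(\mathtt{rec}\,f.t)[\theta;\sigma]\cdot\vec N\,(\mathtt{in}_\mu\,v)\Downarrow w$ if $t[\theta;\sigma,(\mathtt{rec}\,f.t)[\theta;\sigma]/f]\Downarrow c$ and $c\cdot\vec N\,v\Downarrow w$; $(\mathtt{corec}\,f.t)[\theta;\sigma]\cdot\vec N\,v$ evaluates to the closure $(\mathtt{corec}\,f.t)[\theta;\sigma]\cdot\vec N\,v$; $(\mathtt{ind}(t_0,u,f.t_s))[\theta;\sigma]\cdot0\,\langle\rangle\Downarrow w$ if $t_0[\theta;\sigma]\Downarrow w$; $(\mathtt{ind}(t_0,u,f.t_s))[\theta;\sigma]\cdot(\mathsf{suc}\,N)\,\langle\rangle\Downarrow w$ if $(\mathtt{ind}(t_0,u,f.t_s))[\theta;\sigma]\cdot N\,\langle\rangle\Downarrow v$ and $t_s[\theta,N/u;\sigma,v/f]\Downarrow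 w$. (c) $((\mathtt{corec}\,f.t)[\theta;\sigma]\cdot\vec N\,v)\cdot_{\mathtt{out}_\nu}\Downarrow w$ if $t[\theta;\sigma,(\mathtt{corec}\,f.t)[\theta;\sigma]/f]\Downarrow c$ and $c\cdot\vec N\,v\Downarrow w$. VALUE TYPING $v:T$ ($T$ closed). $g[\theta;\sigma]:T[\theta]$ if $\cdot\vdash\theta:\Delta$, $\sigma:\Gamma[\theta]$ and $\Delta;\cdot;\Gamma\vdash g\Leftarrow T$. $\langle\rangle:1$. $\mathtt{refl}:(M=N)$ if $\cdot\vdash M=N$. $\langle v_1,v_2\rangle:T_1\times T_2$ if $v_i:T_i$. $\mathtt{in}_i\,v:T_1+T_2$ if $v:T_i$. $\mathtt{pack}(M,v):\Sigma u{:}U.T$ if $\cdot\vdash M:U$ and $v:T[M/u]$. $\mathtt{in}_\mu\,v:(\mu X{:}K.\Lambda\vec u.T)\,\vec M$ if $v:T[\overrightarrow{M/u};(\mu X{:}K.\Lambda\vec u.T)/X]$. $\mathtt{in}_0\,v:T_{\mathsf{Rec}}\,0\,\vec M$ if $v:T_0\,\vec M$. $\mathtt{in}_{\mathsf{suc}}\,v:T_{\mathsf{Rec}}\,(\mathsf{suc}\,N)\,\vec M$ if $v:T_s[N/u;(T_{\mathsf{Rec}}\,N)/X]\,\vec M$. $(\mathtt{corec}\,f.t)[\theta;\sigma]\cdot\vec N\,v:(\nu X{:}K.\Lambda\overrightarrow{u'}.T)[\theta]\,\vec N$ if $\cdot\vdash\theta:\Delta$, $\sigma:\Gamma[\theta]$,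 $\cdot\vdash\vec N:(\overrightarrow{u{:}U})[\theta]$, $v:S[\theta,\overrightarrow{N/u}]$ and $\Delta;X{:}K;\Gamma,f{:}((\overrightarrow{u{:}U});S\to X\,\vec u)\vdash t\Leftarrow(\overrightarrow{u{:}U});S\to T[\overrightarrow{u/u'}]$ (with $X$ fresh as in the typing rule). Environment typing: $\cdot:\cdot$; $(\sigma,v/x):\Gamma,x{:}T$ if $\sigma:\Gamma$ and $v:T$. *)

(* Defs.v *)
(* Stdlib, vanilla Rocq.

   Syntax is in de Bruijn style with three independent kinds of variables: index variables (u, in
   Delta), type variables (X, in Xi) and term variables (x, in Gamma), so that alpha-equivalence is
   equality.  Contexts and environments are lists whose head is the most recent entry (index 0).
   Spines (u:U) and M are lists in the written order, u0 first; hence Delta, (u:U) is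
   [rev Us ++ Delta] and theta, N/u is [rev Ns ++ theta]. *)
From Stdlib Require Import List.
Import ListNotations.

Set Implicit Arguments.
Unset Strict Implicit.
Set Contextual Implicit.

Definition scons {A : Type} (a : A) (s : nat -> A) (i : nat) : A :=
  match i with 0 => a | S j => s j end.

(** * The index language *)

Record index_syntax := IndexSyntax {
  itm : Type;
  ity : Type;
  ivar : nat -> itm;
  izero : itm;
  isuc : itm -> itm;
  inat : ity;
  isub : (nat -> itm) -> itm -> itm;
  itsub : (nat -> itm) -> ity -> ity;
  isub_var : forall s i, isub s (ivar i) = s i;
  isub_zero : forall s, isub s izero = izero;
  isub_suc : forall s M, isub s (isuc M) = isuc (isub s M);
  isub_id : forall M, isub ivar M = M;
  isub_comp : forall s1 s2 M, isub s2 (isub s1 M) = isub (fun i => isub s2 (s1 i)) M;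
  itsub_nat : forall s, itsub s inat = inat;
  itsub_id : forall U, itsub ivar U = U;
  itsub_comp : forall s1 s2 U, itsub s2 (itsub s1 U) = itsub (fun i => isub s2 (s1 i)) U;
  isuc_inj : forall M N, isuc M = isuc N -> M = N;
  izero_isuc : forall M, izero <> isuc M;
  itm_eq_dec : forall M N : itm, {M = N} + {M <> N}
}.

Arguments ivar {_} _.
Arguments izero {_}.
Arguments isuc {_} _.
Arguments inat {_}.

Section IndexOps.
Variable I : index_syntax.

Definition iext (l : list (itm I)) (s : nat -> itm I) : nat -> itm I := fold_right scons s l.

(* The function denoted by an index substitution Theta.  The value outside the domain is irrelevant
   for well-scoped expressions; a closed one makes e[Theta1][Theta2] = e[Theta1[Theta2]] hold for
   all raw expressions. *)
Definition isubst_of (Th : list (itm I)) : nat -> itm I := iext Th (fun _ => izero).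

(* M0/u0, ..., Mk/uk, the identity on the remaining variables *)
Definition ispine (Ms : list (itm I)) : nat -> itm I := iext (rev Ms) ivar.

Definition ishift (n : nat) : nat -> itm I := fun i => ivar (n + i).

Definition iup (s : nat -> itm I) : nat -> itm I :=
  scons (ivar 0) (fun i => isub (ishift 1) (s i)).

Definition iupn (n : nat) (s : nat -> itm I) : nat -> itm I := Nat.iter n iup s.

(* the composition Theta1[Theta2] *)
Definition icomp (Th1 Th2 : list (itm I)) : list (itm I) := map (isub (isubst_of Th2)) Th1.

(* the spine of variables u0, ..., u(n-1), where u0 is bound outermost *)
Definition ivars (n : nat) : list (itm I) := rev (map ivar (seq 0 n)).

Fixpoint spsub (s : nat -> itm I) (Us : list (ity I)) : list (ity I) :=
  match Us with
  | [] => []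
  | U :: Us' => itsub s U :: spsub (iup s) Us'
  end.

Fixpoint ilookup (D : list (ity I)) (i : nat) : option (ity I) :=
  match D, i with
  | [], _ => None
  | U :: _, 0 => Some (itsub (ishift 1) U)
  | _ :: D', S j => option_map (itsub (ishift 1)) (ilookup D' j)
  end.

End IndexOps.

Record index_judgments := IndexJudgments {
  isyntax :> index_syntax;
  is_itype : list (ity isyntax) -> ity isyntax -> Prop;
  ihas : list (ity isyntax) -> itm isyntax -> ity isyntax -> Prop;
  (* [Some (D', Th)] is (Delta' | Theta) and [None] is # *)
  iunify : list (ity isyntax) -> itm isyntax -> itm isyntax ->
           option (list (ity isyntax) * list (itm isyntax)) -> Prop;
  (* [imatch D1 Th1 Th2 D2 Th] is D1 |- Th1 =. Th2 \ (D2 | Th) *)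
  imatch : list (ity isyntax) -> list (itm isyntax) -> list (itm isyntax) ->
           list (ity isyntax) -> list (itm isyntax) -> Prop
}.

Section IndexJudgments.
Variable J : index_judgments.

Inductive ictx : list (ity J) -> Prop :=
| ictx_nil : ictx []
| ictx_cons D U : ictx D -> is_itype D U -> ictx (U :: D).

(* D' |- Th : D *)
Inductive isubst_ty (D' : list (ity J)) : list (itm J) -> list (ity J) -> Prop :=
| isubst_ty_nil : isubst_ty D' [] []
| isubst_ty_cons Th D M U :
    isubst_ty D' Th D -> ihas D' M (itsub (isubst_of Th) U) ->
    isubst_ty D' (M :: Th) (U :: D).

(* D' |- s : D for substitutions given as functions; this also covers renamings and identities *)
Definition isub_ty (D' : list (ity J)) (s : nat -> itm J) (D : list (ity J)) : Prop :=
  forall i U, ilookup D i = Some U -> ihas D' (s i) (itsub s U).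

Inductive spine_itype : list (ity J) -> list (ity J) -> Prop :=
| spine_itype_nil D : spine_itype D []
| spine_itype_cons D U Us :
    is_itype D U -> spine_itype (U :: D) Us -> spine_itype D (U :: Us).

Inductive spine_ty (D : list (ity J)) : list (itm J) -> list (ity J) -> Prop :=
| spine_ty_nil : spine_ty D [] []
| spine_ty_cons M Ms U Us :
    ihas D M U -> spine_ty D Ms (spsub (ispine [M]) Us) ->
    spine_ty D (M :: Ms) (U :: Us).

(* Index equality is syntactic. *)
Definition ieq (D : list (ity J)) (M N : itm J) : Prop := M = N.

Definition unifies (D' : list (ity J)) (Th : list (itm J)) (D : list (ity J)) (M N : itm J) : Prop :=
  isubst_ty D' Th D /\ ieq D' (isub (isubst_of Th) M) (isub (isubst_of Th) N).

End IndexJudgments.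

Record index_language := IndexLanguage {
  ijudg :> index_judgments;
  ihas_dec : forall (D : list (ity ijudg)) M U, {ihas D M U} + {~ ihas D M U};
  ihas_var : forall (D : list (ity ijudg)) i U,
    ilookup D i = Some U -> ihas D (ivar i) U;
  is_itype_nat : forall D : list (ity ijudg), is_itype D inat;
  ihas_zero : forall D : list (ity ijudg), ihas D izero inat;
  ihas_suc : forall (D : list (ity ijudg)) M,
    ihas D M inat -> ihas D (isuc M) inat;
  ihas_nat_closed : forall M : itm ijudg,
    ihas [] M inat <-> exists n, M = Nat.iter n (@isuc ijudg) izero;
  is_itype_sub : forall D' s D (U : ity ijudg),
    isub_ty D' s D -> is_itype D U -> is_itype D' (itsub s U);
  ihas_sub : forall D' s D M (U : ity ijudg),
    isub_ty D' s D -> ihas D M U -> ihas D' (isub s M) (itsub s U);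
  iunify_dec : forall D M N (U : ity ijudg),
    ihas D M U -> ihas D N U -> {P | iunify D M N P};
  iunify_unique : forall D M N (U : ity ijudg) P P',
    ihas D M U -> ihas D N U ->
    iunify D M N P -> iunify D M N P' -> P = P';
  iunify_mgu : forall D M N (U : ity ijudg) D' Th,
    ihas D M U -> ihas D N U ->
    iunify D M N (Some (D', Th)) ->
    unifies D' Th D M N /\
    forall D'' Th'', unifies D'' Th'' D M N ->
      exists Th0, isubst_ty D'' Th0 D' /\ Th'' = icomp Th Th0;
  iunify_fail : forall D M N (U : ity ijudg),
    ihas D M U -> ihas D N U ->
    iunify D M N None ->
    forall D' Th, ~ unifies D' Th D M N;
  imatch_sound : forall D1 Th1 Th2 D2 Th (D : list (ity ijudg)),
    isubst_ty D1 Th1 D -> imatch D1 Th1 Th2 D2 Th ->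
    isubst_ty D2 Th D1 /\ icomp Th1 Th = Th2;
  imatch_complete : forall D M N (U : ity ijudg) D' Th th,
    ihas D M U -> ihas D N U ->
    isubst_ty [] th D ->
    ieq [] (isub (isubst_of th) M) (isub (isubst_of th) N) ->
    iunify D M N (Some (D', Th)) ->
    exists th', imatch D' Th th [] th'
}.

(** * Kinds, types and terms *)

Section Syntax.
Variable I : index_syntax.

Inductive kind : Type :=
| KStar
| KPi (U : ity I) (K : kind).

Inductive ty : Type :=
| TUnit
| TProd (T1 T2 : ty)
| TSum (T1 T2 : ty)
| TArr (Us : list (ity I)) (T1 T2 : ty)      (* (u:U); T1 -> T2, the u bound in T1 and T2 *)
| TSig (U : ity I) (T : ty)
| TEq (M N : itm I)
| TApp (T : ty) (M : itm I)
| TLam (T : ty)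
| TVar (X : nat)
| TMu (K : kind) (T : ty)
| TNu (K : kind) (T : ty)
| TRec (K : kind) (T0 Ts : ty).              (* Ts is under u and X *)

Inductive label : Type := LZero | LSuc.

Inductive tm : Type :=
| EVar (x : nat)
| EUnit
| ELam (k : nat) (t : tm)                    (* binds k index variables and one x *)
| EApp (t : tm) (Ms : list (itm I)) (s : tm)
| EPair (t1 t2 : tm)
| ESplit (s t : tm)                          (* x1 is 1 and x2 is 0 in t *)
| EInl (t : tm)
| EInr (t : tm)
| ECase (t t1 t2 : tm)
| EPack (M : itm I) (t : tm)
| EUnpack (t s : tm)                         (* s is under u and x *)
| ERefl
| EEq (s : tm) (D : list (ity I)) (Th : list (itm I)) (t : tm)
                                             (* the index variables of t are those of D *)
| EEqAbort (s : tm)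
| EInMu (t : tm)
| ERec (t : tm)
| ECorec (t : tm)
| EOutNu (t : tm)
| EIn (l : label) (t : tm)
| EOut (l : label) (t : tm)
| EInd (t0 ts : tm)                          (* ts is under u and f *)
| EAnn (t : tm) (T : ty).

Definition function_value (g : tm) : Prop :=
  match g with ELam _ _ | ERec _ | ECorec _ | EInd _ _ => True | _ => False end.

Fixpoint ksub (s : nat -> itm I) (K : kind) : kind :=
  match K with
  | KStar => KStar
  | KPi U K' => KPi (itsub s U) (ksub (iup s) K')
  end.

(* index substitution in types *)
Fixpoint tsub (s : nat -> itm I) (T : ty) : ty :=
  match T with
  | TUnit => TUnit
  | TProd T1 T2 => TProd (tsub s T1) (tsub s T2)
  | TSum T1 T2 => TSum (tsub s T1) (tsub s T2)
  | TArr Us T1 T2 =>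
      TArr (spsub s Us) (tsub (iupn (length Us) s) T1) (tsub (iupn (length Us) s) T2)
  | TSig U T' => TSig (itsub s U) (tsub (iup s) T')
  | TEq M N => TEq (isub s M) (isub s N)
  | TApp T' M => TApp (tsub s T') (isub s M)
  | TLam T' => TLam (tsub (iup s) T')
  | TVar X => TVar X
  | TMu K T' => TMu (ksub s K) (tsub s T')
  | TNu K T' => TNu (ksub s K) (tsub s T')
  | TRec K T0 Ts => TRec (ksub s K) (tsub s T0) (tsub (iup s) Ts)
  end.

Definition upren (f : nat -> nat) : nat -> nat := scons 0 (fun X => S (f X)).

(* renaming of type variables *)
Fixpoint tren (f : nat -> nat) (T : ty) : ty :=
  match T with
  | TUnit => TUnit
  | TProd T1 T2 => TProd (tren f T1) (tren f T2)
  | TSum T1 T2 => TSum (tren f T1) (tren f T2)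
  | TArr Us T1 T2 => TArr Us (tren f T1) (tren f T2)
  | TSig U T' => TSig U (tren f T')
  | TEq M N => TEq M N
  | TApp T' M => TApp (tren f T') M
  | TLam T' => TLam (tren f T')
  | TVar X => TVar (f X)
  | TMu K T' => TMu K (tren (upren f) T')
  | TNu K T' => TNu K (tren (upren f) T')
  | TRec K T0 Ts => TRec K (tren f T0) (tren (upren f) Ts)
  end.

(* Type-variable substitution.  Only types that synthesize a kind are ever substituted, and such a
   type is not a lambda, so no redex arises. *)
Fixpoint tvsub (r : nat -> ty) (T : ty) : ty :=
  let under n := fun X => tsub (ishift n) (r X) in
  let up r' := scons (TVar 0) (fun X => tren S (r' X)) in
  match T with
  | TUnit => TUnit
  | TProd T1 T2 => TProd (tvsub r T1) (tvsub r T2)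
  | TSum T1 T2 => TSum (tvsub r T1) (tvsub r T2)
  | TArr Us T1 T2 => TArr Us (tvsub (under (length Us)) T1) (tvsub (under (length Us)) T2)
  | TSig U T' => TSig U (tvsub (under 1) T')
  | TEq M N => TEq M N
  | TApp T' M => TApp (tvsub r T') M
  | TLam T' => TLam (tvsub (under 1) T')
  | TVar X => r X
  | TMu K T' => TMu K (tvsub (up r) T')
  | TNu K T' => TNu K (tvsub (up r) T')
  | TRec K T0 Ts => TRec K (tvsub r T0) (tvsub (up (under 1)) Ts)
  end.

(* renaming of the type variables in annotations *)
Fixpoint eren (f : nat -> nat) (t : tm) : tm :=
  match t with
  | EVar x => EVar x
  | EUnit => EUnit
  | ELam k t => ELam k (eren f t)
  | EApp t Ms s => EApp (eren f t) Ms (eren f s)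
  | EPair t1 t2 => EPair (eren f t1) (eren f t2)
  | ESplit s t => ESplit (eren f s) (eren f t)
  | EInl t => EInl (eren f t)
  | EInr t => EInr (eren f t)
  | ECase t t1 t2 => ECase (eren f t) (eren f t1) (eren f t2)
  | EPack M t => EPack M (eren f t)
  | EUnpack t s => EUnpack (eren f t) (eren f s)
  | ERefl => ERefl
  | EEq s D Th t => EEq (eren f s) D Th (eren f t)
  | EEqAbort s => EEqAbort (eren f s)
  | EInMu t => EInMu (eren f t)
  | ERec t => ERec (eren f t)
  | ECorec t => ECorec (eren f t)
  | EOutNu t => EOutNu (eren f t)
  | EIn l t => EIn l (eren f t)
  | EOut l t => EOut l (eren f t)
  | EInd t0 ts => EInd (eren f t0) (eren f ts)
  | EAnn t T => EAnn (eren f t) (tren f T)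
  end.

(* Application of a type to an index term, with (Lam u.T) M identified with T[M/u].  A lambda only
   checks against a kind whereas the head of a [TApp] must synthesize one, so well-kinded types
   contain no redex and serve as the representatives of the identified types. *)
Definition tapp (T : ty) (M : itm I) : ty :=
  match T with TLam B => tsub (ispine [M]) B | _ => TApp T M end.

Definition tapps (T : ty) (Ms : list (itm I)) : ty := fold_left tapp Ms T.

Definition tlams (k : nat) (T : ty) : ty := Nat.iter k TLam T.

Definition kpis (Us : list (ity I)) : kind := fold_right KPi KStar Us.

(* T[M/u; R/X]; as R lives outside the scope of the u, the two substitutions can be done in turn. *)
Definition tinst (Ms : list (itm I)) (R T : ty) : ty :=
  tvsub (scons R (fun X => TVar X)) (tsub (ispine Ms) T).

(* the types mu and nu with body Lam u.T applied to M; the number of binders is the length of M *)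
Definition tmu_app (K : kind) (T : ty) (Ms : list (itm I)) : ty :=
  tapps (TMu K (tlams (length Ms) T)) Ms.
Definition tnu_app (K : kind) (T : ty) (Ms : list (itm I)) : ty :=
  tapps (TNu K (tlams (length Ms) T)) Ms.

Definition tmu_unfold (K : kind) (T : ty) (Ms : list (itm I)) : ty :=
  tinst Ms (TMu K (tlams (length Ms) T)) T.
Definition tnu_unfold (K : kind) (T : ty) (Ms : list (itm I)) : ty :=
  tinst Ms (TNu K (tlams (length Ms) T)) T.

(* (Ts[N/u; (T_Rec N)/X]) M for T_Rec = Rec_K (T0 | Ts) *)
Definition trec_suc (K : kind) (T0 Ts : ty) (N : itm I) (Ms : list (itm I)) : ty :=
  tapps (tinst [N] (TApp (TRec K T0 Ts) N) Ts) Ms.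

End Syntax.

(** * Kinding *)

Section Static.
Variable L : index_language.

Definition kshift (n : nat) (Xi : list (kind L)) : list (kind L) := map (ksub (ishift n)) Xi.
Definition tshift (n : nat) : ty L -> ty L := tsub (ishift n).
Definition cshift (n : nat) (G : list (ty L)) : list (ty L) := map (tshift n) G.

Inductive kcheck : list (ity L) -> list (kind L) -> ty L -> kind L -> Prop :=
| kc_unit D Xi : kcheck D Xi TUnit KStar
| kc_prod D Xi T1 T2 :
    kcheck D Xi T1 KStar -> kcheck D Xi T2 KStar -> kcheck D Xi (TProd T1 T2) KStar
| kc_sum D Xi T1 T2 :
    kcheck D Xi T1 KStar -> kcheck D Xi T2 KStar -> kcheck D Xi (TSum T1 T2) KStar
| kc_arr D Xi Us T1 T2 :
    spine_itype D Us ->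
    kcheck (rev Us ++ D) (kshift (length Us) Xi) T1 KStar ->
    kcheck (rev Us ++ D) (kshift (length Us) Xi) T2 KStar ->
    kcheck D Xi (TArr Us T1 T2) KStar
| kc_sig D Xi U T :
    is_itype D U -> kcheck (U :: D) (kshift 1 Xi) T KStar -> kcheck D Xi (TSig U T) KStar
| kc_eq D Xi M N U : ihas D M U -> ihas D N U -> kcheck D Xi (TEq M N) KStar
| kc_lam D Xi U K T : kcheck (U :: D) (kshift 1 Xi) T K -> kcheck D Xi (TLam T) (KPi U K)
| kc_synth D Xi T : ksynth D Xi T KStar -> kcheck D Xi T KStar
with ksynth : list (ity L) -> list (kind L) -> ty L -> kind L -> Prop :=
| ks_var D Xi X K : nth_error Xi X = Some K -> ksynth D Xi (TVar X) K
| ks_app D Xi T M U K :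
    ksynth D Xi T (KPi U K) -> ihas D M U -> ksynth D Xi (TApp T M) (ksub (ispine [M]) K)
| ks_mu D Xi K T : kcheck D (K :: Xi) T K -> ksynth D Xi (TMu K T) K
| ks_nu D Xi K T : kcheck D (K :: Xi) T K -> ksynth D Xi (TNu K T) K
| ks_rec D Xi K T0 Ts :
    kcheck D Xi T0 (ksub (ispine [izero]) K) ->
    kcheck (inat :: D) (K :: kshift 1 Xi) Ts (ksub (scons (isuc (ivar 0)) (ishift 1)) K) ->
    ksynth D Xi (TRec (KPi inat K) T0 Ts) (KPi inat K).

Inductive kind_wf : list (ity L) -> kind L -> Prop :=
| kwf_star D : kind_wf D KStar
| kwf_pi D U K : is_itype D U -> kind_wf (U :: D) K -> kind_wf D (KPi U K).

(** * Typing *)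

(* what the typing judgments Delta; Xi; Gamma |- t : T presuppose *)
Definition presup (D : list (ity L)) (Xi : list (kind L)) (G : list (ty L)) (T : ty L) : Prop :=
  ictx D /\ Forall (kind_wf D) Xi /\
  Forall (fun A => kcheck D Xi A KStar) G /\ kcheck D Xi T KStar.

(* [check] and [synth] are the judgments, [check_rule] and [synth_rule] their rules: every node of
   a derivation satisfies the presuppositions.

   In the rules for rec and corec, [tren S] and [eren S] express that X does not occur in the
   conclusion; the body of mu or nu is under the v, which have the types of the u, so that S[u/v]
   is the same de Bruijn type. *)
Inductive check : list (ity L) -> list (kind L) -> list (ty L) -> tm L -> ty L -> Prop :=
| Check D Xi G t T : presup D Xi G T -> check_rule D Xi G t T -> check D Xi G t T
with synth : list (ity L) -> list (kind L) -> list (ty L) -> tm L -> ty L -> Prop :=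
| Synth D Xi G t T : presup D Xi G T -> synth_rule D Xi G t T -> synth D Xi G t T
with check_rule : list (ity L) -> list (kind L) -> list (ty L) -> tm L -> ty L -> Prop :=
| c_unit D Xi G : check_rule D Xi G EUnit TUnit
| c_pair D Xi G t1 t2 T1 T2 :
    check D Xi G t1 T1 -> check D Xi G t2 T2 -> check_rule D Xi G (EPair t1 t2) (TProd T1 T2)
| c_split D Xi G p t T1 T2 T :
    synth D Xi G p (TProd T1 T2) -> check D Xi (T2 :: T1 :: G) t T ->
    check_rule D Xi G (ESplit p t) T
| c_inl D Xi G t T1 T2 : check D Xi G t T1 -> check_rule D Xi G (EInl t) (TSum T1 T2)
| c_inr D Xi G t T1 T2 : check D Xi G t T2 -> check_rule D Xi G (EInr t) (TSum T1 T2)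
| c_case D Xi G t t1 t2 T1 T2 T :
    synth D Xi G t (TSum T1 T2) -> check D Xi (T1 :: G) t1 T -> check D Xi (T2 :: G) t2 T ->
    check_rule D Xi G (ECase t t1 t2) T
| c_pack D Xi G M t U T :
    ihas D M U -> check D Xi G t (tsub (ispine [M]) T) ->
    check_rule D Xi G (EPack M t) (TSig U T)
| c_unpack D Xi G t s U T T' :
    synth D Xi G t (TSig U T) ->
    check (U :: D) (kshift 1 Xi) (T :: cshift 1 G) s (tshift 1 T') ->
    check_rule D Xi G (EUnpack t s) T'
| c_refl D Xi G M N : ieq D M N -> check_rule D Xi G ERefl (TEq M N)
| c_eq_abort D Xi G s M N T :
    synth D Xi G s (TEq M N) -> iunify D M N None -> check_rule D Xi G (EEqAbort s) T
| c_eq D Xi G s D' Th t M N T :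
    synth D Xi G s (TEq M N) -> iunify D M N (Some (D', Th)) ->
    check D' (map (ksub (isubst_of Th)) Xi) (map (tsub (isubst_of Th)) G) t
          (tsub (isubst_of Th) T) ->
    check_rule D Xi G (EEq s D' Th t) T
| c_lam D Xi G t Us T1 T2 :
    check (rev Us ++ D) (kshift (length Us) Xi) (T1 :: cshift (length Us) G) t T2 ->
    check_rule D Xi G (ELam (length Us) t) (TArr Us T1 T2)
| c_in_mu D Xi G t K T Ms :
    check D Xi G t (tmu_unfold K T Ms) -> check_rule D Xi G (EInMu t) (tmu_app K T Ms)
| c_rec D Xi G t Us A T :
    check D (kpis Us :: Xi)
          (TArr Us (tapps (TVar 0) (ivars (length Us))) (tren S T) :: map (tren S) G)
          (eren S t)
          (TArr Us A (tren S T)) ->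
    check_rule D Xi G (ERec t)
      (TArr Us (tapps (tshift (length Us) (TMu (kpis Us) (tlams (length Us) A)))
                      (ivars (length Us)))
               T)
| c_corec D Xi G t Us A T :
    check D (kpis Us :: Xi)
          (TArr Us (tren S A) (tapps (TVar 0) (ivars (length Us))) :: map (tren S) G)
          (eren S t)
          (TArr Us (tren S A) T) ->
    check_rule D Xi G (ECorec t)
      (TArr Us A
               (tapps (tshift (length Us) (TNu (kpis Us) (tlams (length Us) T)))
                      (ivars (length Us))))
| c_ind D Xi G t0 ts T :
    check D Xi G t0 (tsub (ispine [izero]) T) ->
    check (inat :: D) (kshift 1 Xi) (T :: cshift 1 G) ts
          (tsub (scons (isuc (ivar 0)) (ishift 1)) T) ->
    check_rule D Xi G (EInd t0 ts) (TArr [inat] TUnit T)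
| c_in_zero D Xi G t K T0 Ts Ms :
    check D Xi G t (tapps T0 Ms) ->
    check_rule D Xi G (EIn LZero t) (tapps (TRec K T0 Ts) (izero :: Ms))
| c_in_suc D Xi G t K T0 Ts N Ms :
    check D Xi G t (trec_suc K T0 Ts N Ms) ->
    check_rule D Xi G (EIn LSuc t) (tapps (TRec K T0 Ts) (isuc N :: Ms))
| c_synth D Xi G t T : synth D Xi G t T -> check_rule D Xi G t T
with synth_rule : list (ity L) -> list (kind L) -> list (ty L) -> tm L -> ty L -> Prop :=
| s_var D Xi G x T : nth_error G x = Some T -> synth_rule D Xi G (EVar x) T
| s_app D Xi G t Ms s Us T1 T2 :
    synth D Xi G t (TArr Us T1 T2) -> spine_ty D Ms Us ->
    check D Xi G s (tsub (ispine Ms) T1) ->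
    synth_rule D Xi G (EApp t Ms s) (tsub (ispine Ms) T2)
| s_out_zero D Xi G t K T0 Ts Ms :
    synth D Xi G t (tapps (TRec K T0 Ts) (izero :: Ms)) ->
    synth_rule D Xi G (EOut LZero t) (tapps T0 Ms)
| s_out_suc D Xi G t K T0 Ts N Ms :
    synth D Xi G t (tapps (TRec K T0 Ts) (isuc N :: Ms)) ->
    synth_rule D Xi G (EOut LSuc t) (trec_suc K T0 Ts N Ms)
| s_out_nu D Xi G t K T Ms :
    synth D Xi G t (tnu_app K T Ms) -> synth_rule D Xi G (EOutNu t) (tnu_unfold K T Ms)
| s_ann D Xi G t T : check D Xi G t T -> synth_rule D Xi G (EAnn t T) T.

End Static.

(** * Evaluation *)

Section Dynamic.
Variable L : index_language.

Inductive val : Type :=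
| VClo (g : tm L) (th : list (itm L)) (sg : list val)           (* g[th; sg] *)
| VCorec (t : tm L) (th : list (itm L)) (sg : list val) (Ns : list (itm L)) (v : val)
                                                                (* (corec f.t)[th; sg] . N v *)
| VUnit
| VPair (v1 v2 : val)
| VInl (v : val)
| VInr (v : val)
| VPack (M : itm L) (v : val)
| VRefl
| VInMu (v : val)
| VIn (l : label) (v : val).

(* [eval t th sg v], [apply c Ns v w] and [out_nu c w] are the three evaluation judgments. *)
Inductive eval : tm L -> list (itm L) -> list val -> val -> Prop :=
| ev_var x th sg v : nth_error sg x = Some v -> eval (EVar x) th sg v
| ev_unit th sg : eval EUnit th sg VUnit
| ev_refl th sg : eval ERefl th sg VRefl
| ev_fun g th sg : function_value g -> eval g th sg (VClo g th sg)
| ev_pair t1 t2 th sg v1 v2 :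
    eval t1 th sg v1 -> eval t2 th sg v2 -> eval (EPair t1 t2) th sg (VPair v1 v2)
| ev_inl t th sg v : eval t th sg v -> eval (EInl t) th sg (VInl v)
| ev_inr t th sg v : eval t th sg v -> eval (EInr t) th sg (VInr v)
| ev_in_mu t th sg v : eval t th sg v -> eval (EInMu t) th sg (VInMu v)
| ev_in l t th sg v : eval t th sg v -> eval (EIn l t) th sg (VIn l v)
| ev_pack M t th sg v :
    eval t th sg v -> eval (EPack M t) th sg (VPack (isub (isubst_of th) M) v)
| ev_ann t T th sg v : eval t th sg v -> eval (EAnn t T) th sg v
| ev_split t s th sg v1 v2 v :
    eval t th sg (VPair v1 v2) -> eval s th (v2 :: v1 :: sg) v -> eval (ESplit t s) th sg v
| ev_case_l t t1 t2 th sg v' v :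
    eval t th sg (VInl v') -> eval t1 th (v' :: sg) v -> eval (ECase t t1 t2) th sg v
| ev_case_r t t1 t2 th sg v' v :
    eval t th sg (VInr v') -> eval t2 th (v' :: sg) v -> eval (ECase t t1 t2) th sg v
| ev_unpack t s th sg N v' v :
    eval t th sg (VPack N v') -> eval s (N :: th) (v' :: sg) v -> eval (EUnpack t s) th sg v
| ev_eq s D Th t th sg th' v :
    eval s th sg VRefl -> imatch D Th th [] th' -> eval t th' sg v ->
    eval (EEq s D Th t) th sg v
| ev_out l t th sg v : eval t th sg (VIn l v) -> eval (EOut l t) th sg v
| ev_out_nu t th sg c w : eval t th sg c -> out_nu c w -> eval (EOutNu t) th sg w
| ev_app t Ms s th sg c v w :
    eval t th sg c -> eval s th sg v -> apply c (map (isub (isubst_of th)) Ms) v w ->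
    eval (EApp t Ms s) th sg w
with apply : val -> list (itm L) -> val -> val -> Prop :=
| ap_lam k t th sg Ns v w :
    length Ns = k -> eval t (rev Ns ++ th) (v :: sg) w -> apply (VClo (ELam k t) th sg) Ns v w
| ap_rec t th sg Ns v c w :
    eval t th (VClo (ERec t) th sg :: sg) c -> apply c Ns v w ->
    apply (VClo (ERec t) th sg) Ns (VInMu v) w
| ap_corec t th sg Ns v : apply (VClo (ECorec t) th sg) Ns v (VCorec t th sg Ns v)
| ap_ind_zero t0 ts th sg w :
    eval t0 th sg w -> apply (VClo (EInd t0 ts) th sg) [izero] VUnit w
| ap_ind_suc t0 ts th sg N v w :
    apply (VClo (EInd t0 ts) th sg) [N] VUnit v ->
    eval ts (N :: th) (v :: sg) w ->
    apply (VClo (EInd t0 ts) th sg) [isuc N] VUnit w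
with out_nu : val -> val -> Prop :=
| on_corec t th sg Ns v c w :
    eval t th (VClo (ECorec t) th sg :: sg) c -> apply c Ns v w ->
    out_nu (VCorec t th sg Ns v) w.

(** * Value typing *)

(* As for terms, [val_ty] is the judgment (for well-kinded closed types) and [val_rule] its rules.
   [env_ty sg G] is the typing sg : G of environments. *)
Inductive val_ty : val -> ty L -> Prop :=
| ValTy v T : kcheck [] [] T KStar -> val_rule v T -> val_ty v T
with val_rule : val -> ty L -> Prop :=
| v_clo g th sg D G T :
    function_value g -> isubst_ty [] th D -> env_ty sg (map (tsub (isubst_of th)) G) ->
    check D [] G g T ->
    val_rule (VClo g th sg) (tsub (isubst_of th) T)
| v_unit : val_rule VUnit TUnit
| v_refl M N : ieq [] M N -> val_rule VRefl (TEq M N)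
| v_pair v1 v2 T1 T2 : val_ty v1 T1 -> val_ty v2 T2 -> val_rule (VPair v1 v2) (TProd T1 T2)
| v_inl v T1 T2 : val_ty v T1 -> val_rule (VInl v) (TSum T1 T2)
| v_inr v T1 T2 : val_ty v T2 -> val_rule (VInr v) (TSum T1 T2)
| v_pack M v U T :
    ihas [] M U -> val_ty v (tsub (ispine [M]) T) -> val_rule (VPack M v) (TSig U T)
| v_in_mu v K T Ms : val_ty v (tmu_unfold K T Ms) -> val_rule (VInMu v) (tmu_app K T Ms)
| v_in_zero v K T0 Ts Ms :
    val_ty v (tapps T0 Ms) -> val_rule (VIn LZero v) (tapps (TRec K T0 Ts) (izero :: Ms))
| v_in_suc v K T0 Ts N Ms :
    val_ty v (trec_suc K T0 Ts N Ms) ->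
    val_rule (VIn LSuc v) (tapps (TRec K T0 Ts) (isuc N :: Ms))
| v_corec t th sg Ns v D G Us A T :
    isubst_ty [] th D -> env_ty sg (map (tsub (isubst_of th)) G) ->
    spine_ty [] Ns (spsub (isubst_of th) Us) ->
    val_ty v (tsub (isubst_of (rev Ns ++ th)) A) ->
    check D [kpis Us]
          (TArr Us (tren S A) (tapps (TVar 0) (ivars (length Us))) :: map (tren S) G)
          (eren S t)
          (TArr Us (tren S A) T) ->
    val_rule (VCorec t th sg Ns v)
      (tapps (tsub (isubst_of th) (TNu (kpis Us) (tlams (length Us) T))) Ns)
with env_ty : list val -> list (ty L) -> Prop :=
| env_nil : env_ty [] []
| env_cons sg G v T : env_ty sg G -> val_ty v T -> env_ty (v :: sg) (T :: G).

End Dynamic.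

(* Main.v *)
(* Simultaneous induction on the three evaluation judgments.  Closures carry their environments, so
   no substitution into terms is needed, except for the type variable X in the bodies of rec and
   corec: typing is stable under replacing X by the recursive type itself, which turns the premise of
   the rule into a typing of the same body in the context extended by the function being defined.
   The index environment of a closure plays the role of an index substitution in types, and the
   soundness of matching makes the eq case an instance of composition of index substitutions. *)

(* The function applied next in the evaluation rules is often a closure that itself results from
   evaluation, of which only a closed type is known. Application is therefore proved sound for typed
   closures ([apply_sound]), and the typing of their code is recovered by inversion.

   Two features of the rules shape the auxiliary lemmas. Every node of a typing derivation carries
   kinding presuppositions, so replacing [X] must preserve kinding at each node. And applied lambdas
   are identified with their contracta, a contraction that [tapps] performs: replacing a head
   variable by a lambda would create a redex that [tvsub] leaves alone. Recursive types synthesize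
   their kinds and so are never lambdas; this is the source of the [nonlam] side conditions.
   Conversely, reading the components of a value rule off a type needs a unique decomposition of
   applied types into head and spine, [tapps_inj]. *)
Require Import Defs.
From Stdlib Require Import List Lia FunctionalExtensionality.
Import ListNotations.

Set Implicit Arguments.
Unset Strict Implicit.

(** * Index substitutions *)

Section IndexCalculus.
Variable I : index_syntax.
Implicit Types (s : nat -> itm I) (Ms th : list (itm I)) (M : itm I).

Definition iseq s1 s2 : nat -> itm I := fun i => isub s2 (s1 i).

Lemma isub_iseq s1 s2 M : isub s2 (isub s1 M) = isub (iseq s1 s2) M.
Proof. apply isub_comp. Qed.

Lemma itsub_iseq s1 s2 (U : ity I) : itsub s2 (itsub s1 U) = itsub (iseq s1 s2) U.
Proof. apply itsub_comp. Qed.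

Lemma iseq_ivar_l s : iseq (@ivar I) s = s.
Proof. extensionality i. exact isub_var. Qed.

Lemma iseq_ishift_scons M s : iseq (ishift 1) (scons M s) = s.
Proof. extensionality i. exact isub_var. Qed.

Lemma iup_ivar : iup (@ivar I) = @ivar I.
Proof. extensionality i. destruct i; simpl; [reflexivity | exact isub_var]. Qed.

Lemma iseq_ishift_iup s : iseq (ishift 1) (iup s) = iseq s (ishift 1).
Proof. extensionality i. exact isub_var. Qed.

Lemma iup_iseq s1 s2 : iseq (iup s1) (iup s2) = iup (iseq s1 s2).
Proof.
  extensionality i. destruct i as [|i].
  - exact isub_var.
  - change (isub (iup s2) (isub (ishift 1) (s1 i)) = isub (ishift 1) (isub s2 (s1 i))).
    rewrite !isub_iseq, iseq_ishift_iup. reflexivity.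
Qed.

Lemma iupn_ivar n : iupn n (@ivar I) = @ivar I.
Proof. induction n as [|n IH]; simpl; [reflexivity | rewrite IH; apply iup_ivar]. Qed.

Lemma iupn_iseq n s1 s2 : iseq (iupn n s1) (iupn n s2) = iupn n (iseq s1 s2).
Proof.
  induction n as [|n IH]; [reflexivity|].
  change (iseq (iup (iupn n s1)) (iup (iupn n s2)) = iup (iupn n (iseq s1 s2))).
  rewrite iup_iseq, IH. reflexivity.
Qed.

Lemma iupn_iup n s : iupn n (iup s) = iupn (S n) s.
Proof. unfold iupn. rewrite PeanoNat.Nat.iter_succ_r. reflexivity. Qed.

Lemma iseq_ishift m n : iseq (ishift m) (ishift n) = @ishift I (n + m).
Proof.
  extensionality i. unfold iseq, ishift. rewrite isub_var. f_equal. lia.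
Qed.

Lemma ishift_0 : @ishift I 0 = @ivar I.
Proof. reflexivity. Qed.

Lemma iupn_lt n s i : i < n -> iupn n s i = ivar i.
Proof.
  revert i; induction n as [|n IH]; intros [|i] Hi; try lia; try reflexivity.
  simpl. rewrite IH by lia. exact isub_var.
Qed.

Lemma iupn_ge n s i : iupn n s (n + i) = isub (ishift n) (s i).
Proof.
  induction n as [|n IH]; simpl; [symmetry; apply isub_id|].
  change (isub (ishift 1) (iupn n s (n + i)) = isub (ishift (S n)) (s i)).
  rewrite IH, isub_iseq, iseq_ishift. reflexivity.
Qed.

Lemma iseq_ishift_iupn n s : iseq (ishift n) (iupn n s) = iseq s (ishift n).
Proof.
  extensionality i. unfold iseq at 1, ishift at 1. rewrite isub_var. apply iupn_ge.
Qed.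

Lemma iext_ge th s i : iext th s (length th + i) = s i.
Proof. induction th; auto. Qed.

Lemma iext_lt th s s' i : i < length th -> iext th s i = iext th s' i.
Proof.
  revert i; induction th as [|M th IH]; intros [|i] Hi; simpl in *; try lia; auto.
  apply IH; lia.
Qed.

Lemma iext_map th s s' i :
  isub s' (iext th s i) = iext (map (isub s') th) (iseq s s') i.
Proof.
  revert i; induction th as [|M th IH]; intros [|i]; simpl; auto.
Qed.

Lemma iext_app th th' s : iext (th ++ th') s = iext th (iext th' s).
Proof. apply fold_right_app. Qed.

Lemma iseq_ishift_iext n th s : length th = n -> iseq (ishift n) (iext th s) = s.
Proof.
  intros <-. extensionality i. unfold iseq, ishift. rewrite isub_var. apply iext_ge.
Qed.

(** Below [length th] the lifted [s] is the identity and [th] answers; above it the shift in the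
    lifting cancels against the extension. The laws for spines and for extended environments are
    instances. *)
Lemma iseq_iupn_iext n s th s' :
  length th = n -> iseq (iupn n s) (iext th s') = iext th (iseq s s').
Proof.
  intros <-. extensionality i. unfold iseq at 1.
  destruct (PeanoNat.Nat.lt_ge_cases i (length th)) as [Hi|Hi].
  - rewrite iupn_lt, isub_var by assumption. apply iext_lt; assumption.
  - replace i with (length th + (i - length th)) by lia.
    rewrite iupn_ge, iext_ge, isub_iseq, iseq_ishift_iext; reflexivity.
Qed.

Lemma iseq_ishift_ispine n Ms : length Ms = n -> iseq (ishift n) (ispine Ms) = @ivar I.
Proof. intros <-. apply iseq_ishift_iext, length_rev. Qed.

Lemma iseq_ispine n Ms s :
  length Ms = n -> iseq (ispine Ms) s = iseq (iupn n s) (ispine (map (isub s) Ms)).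
Proof.
  intros <-. unfold ispine. rewrite iseq_iupn_iext by (rewrite length_rev, length_map; reflexivity).
  replace (iseq s (@ivar I)) with s by (extensionality i; symmetry; apply isub_id).
  extensionality i. unfold iseq. rewrite iext_map, iseq_ivar_l, map_rev. reflexivity.
Qed.

Lemma iseq_iupn_ispine n Ms th :
  length Ms = n -> iseq (iupn n (isubst_of th)) (ispine Ms) = isubst_of (rev Ms ++ th).
Proof.
  intros <-. unfold ispine. rewrite iseq_iupn_iext by apply length_rev.
  unfold isubst_of. rewrite iext_app. f_equal. extensionality j. apply isub_id.
Qed.

(** Outside the domain both sides give [izero], which every substitution fixes. *)
Lemma isubst_of_icomp th1 th2 : isubst_of (icomp th1 th2) = iseq (isubst_of th1) (isubst_of th2).
Proof.
  extensionality i. unfold iseq, isubst_of at 3. rewrite iext_map.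
  replace (iseq (fun _ => izero) (isubst_of th2)) with (fun _ : nat => @izero I);
    [reflexivity|].
  extensionality j. symmetry. apply isub_zero.
Qed.

Lemma iseq_iup_ispine s M : iseq (iup s) (ispine [M]) = scons M s.
Proof.
  change (iseq (iupn 1 s) (iext [M] (@ivar I)) = iext [M] s).
  rewrite iseq_iupn_iext by reflexivity. f_equal. extensionality i. apply isub_id.
Qed.

Lemma map_iext_ivar th s : map (isub (iext th s)) (map ivar (seq 0 (length th))) = th.
Proof.
  rewrite map_map. induction th as [|M th IH]; [reflexivity|].
  cbn [length seq map]. f_equal; [exact isub_var|].
  rewrite <- seq_shift, map_map. etransitivity; [|exact IH].
  apply map_ext. intros i. rewrite !isub_var. reflexivity.
Qed.

(** Turns the occurrence [X u] of a recursive type in a rule into [X N] once the arguments are in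
    the environment. Spines run outermost first and environments innermost first, so the two
    reversals cancel. *)
Lemma map_ivars_iext n Ms s : length Ms = n -> map (isub (iext (rev Ms) s)) (ivars n) = Ms.
Proof.
  intros <-. unfold ivars. rewrite map_rev, <- (length_rev Ms), map_iext_ivar.
  apply rev_involutive.
Qed.

(** * Index substitution in spines, kinds and types *)

Lemma length_spsub s (Us : list (ity I)) : length (spsub s Us) = length Us.
Proof. revert s; induction Us; simpl; auto. Qed.

Lemma spsub_ivar (Us : list (ity I)) : spsub (@ivar I) Us = Us.
Proof.
  induction Us as [|U Us IH]; simpl; [reflexivity|]. rewrite iup_ivar, IH, itsub_id. reflexivity.
Qed.

Lemma spsub_spsub s1 s2 (Us : list (ity I)) : spsub s2 (spsub s1 Us) = spsub (iseq s1 s2) Us.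
Proof.
  revert s1 s2; induction Us as [|U Us IH]; intros; simpl; [reflexivity|].
  rewrite IH, iup_iseq, itsub_iseq. reflexivity.
Qed.

Lemma ksub_ivar (K : kind I) : ksub (@ivar I) K = K.
Proof. induction K; simpl; [reflexivity|]. rewrite iup_ivar, IHK, itsub_id. reflexivity. Qed.

Lemma ksub_ksub s1 s2 (K : kind I) : ksub s2 (ksub s1 K) = ksub (iseq s1 s2) K.
Proof.
  revert s1 s2; induction K as [|U K IH]; intros; simpl; [reflexivity|].
  rewrite IH, iup_iseq, itsub_iseq. reflexivity.
Qed.

Lemma tsub_ivar (T : ty I) : tsub (@ivar I) T = T.
Proof.
  induction T; simpl; rewrite ?iupn_ivar, ?iup_ivar, ?spsub_ivar, ?itsub_id, ?isub_id, ?ksub_ivar;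
    f_equal; auto.
Qed.

Lemma tsub_tsub s1 s2 (T : ty I) : tsub s2 (tsub s1 T) = tsub (iseq s1 s2) T.
Proof.
  revert s1 s2; induction T; intros; simpl;
    rewrite ?length_spsub, ?spsub_spsub, ?itsub_iseq, ?isub_iseq, ?ksub_ksub,
      <- ?iupn_iseq, <- ?iup_iseq; f_equal; auto.
Qed.

(** * Type-variable substitutions *)

Implicit Types (T R : ty I) (r : nat -> ty I) (f : nat -> nat).

(** [tvunder] and [tvup] are the local [under] and [up] of [tvsub], named so that their laws can be
    stated. *)
Definition tvunder n r : nat -> ty I := fun X => tsub (ishift n) (r X).
Definition tvup r : nat -> ty I := scons (TVar 0) (fun X => tren S (r X)).
Definition tvone R : nat -> ty I := scons R (fun X => TVar X).

Lemma tsub_tren s f T : tsub s (tren f T) = tren f (tsub s T).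
Proof. revert s f; induction T; intros; simpl; f_equal; auto. Qed.

Lemma tvunder_0 r : tvunder 0 r = r.
Proof. extensionality X. apply tsub_ivar. Qed.

Lemma tvunder_tvunder m n r : tvunder m (tvunder n r) = tvunder (m + n) r.
Proof. extensionality X. unfold tvunder. rewrite tsub_tsub, iseq_ishift. reflexivity. Qed.

Lemma tvunder_tvup n r : tvunder n (tvup r) = tvup (tvunder n r).
Proof. extensionality X. destruct X; [reflexivity|]. apply tsub_tren. Qed.

Lemma tsub_tvup s r : (fun X => tsub s (tvup r X)) = tvup (fun X => tsub s (r X)).
Proof. extensionality X. destruct X; [reflexivity|]. apply tsub_tren. Qed.

Lemma tsub_iupn_tvunder n s r :
  (fun X => tsub (iupn n s) (tvunder n r X)) = tvunder n (fun X => tsub s (r X)).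
Proof.
  extensionality X. unfold tvunder. rewrite !tsub_tsub, iseq_ishift_iupn. reflexivity.
Qed.

Lemma tsub_tvsub s r T : tsub s (tvsub r T) = tvsub (fun X => tsub s (r X)) (tsub s T).
Proof.
  revert s r; induction T; intros; simpl; f_equal; auto.
  - rewrite length_spsub, IHT1. f_equal. apply tsub_iupn_tvunder.
  - rewrite length_spsub, IHT2. f_equal. apply tsub_iupn_tvunder.
  - rewrite IHT. f_equal. apply (tsub_iupn_tvunder 1).
  - rewrite IHT. f_equal. apply (tsub_iupn_tvunder 1).
  - rewrite IHT. f_equal. apply tsub_tvup.
  - rewrite IHT. f_equal. apply tsub_tvup.
  - rewrite IHT2. f_equal. etransitivity; [apply tsub_tvup|].
    exact (f_equal tvup (tsub_iupn_tvunder 1 s r)).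
Qed.

Lemma tvsub_tren r f T : tvsub r (tren f T) = tvsub (fun X => r (f X)) T.
Proof.
  revert r f; induction T; intros; simpl; f_equal; auto.
  - apply IHT1.
  - apply IHT2.
  - apply IHT.
  - apply IHT.
  - rewrite IHT. f_equal. extensionality X. destruct X; reflexivity.
  - rewrite IHT. f_equal. extensionality X. destruct X; reflexivity.
  - rewrite IHT2. f_equal. extensionality X. destruct X; reflexivity.
Qed.

Lemma tvsub_TVar f T : tvsub (fun X => TVar (f X)) T = tren f T.
Proof.
  revert f; induction T; intros; simpl; f_equal; auto.
  - rewrite <- IHT. f_equal. extensionality X. destruct X; reflexivity.
  - rewrite <- IHT. f_equal. extensionality X. destruct X; reflexivity.
  - rewrite <- IHT2. f_equal. extensionality X. destruct X; reflexivity.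
Qed.

Lemma tren_id T : tren (fun X => X) T = T.
Proof.
  assert (Hup : upren (fun X => X) = (fun X => X)) by (extensionality X; destruct X; reflexivity).
  induction T; simpl; rewrite ?Hup; f_equal; auto.
Qed.

Lemma tren_tren f g T : tren f (tren g T) = tren (fun X => f (g X)) T.
Proof. rewrite <- (tvsub_TVar f), tvsub_tren. apply tvsub_TVar. Qed.

Lemma tren_tvup f r :
  (fun X => tren (upren f) (tvup r X)) = tvup (fun X => tren f (r X)).
Proof.
  extensionality X. destruct X; [reflexivity|]. simpl. rewrite !tren_tren. reflexivity.
Qed.

Lemma tren_tvsub f r T : tren f (tvsub r T) = tvsub (fun X => tren f (r X)) T.
Proof.
  revert f r; induction T; intros; simpl; f_equal; auto.
  - rewrite IHT1. f_equal. extensionality X. symmetry. apply tsub_tren.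
  - rewrite IHT2. f_equal. extensionality X. symmetry. apply tsub_tren.
  - rewrite IHT. f_equal. extensionality X. symmetry. apply tsub_tren.
  - rewrite IHT. f_equal. extensionality X. symmetry. apply tsub_tren.
  - rewrite IHT. f_equal. apply tren_tvup.
  - rewrite IHT. f_equal. apply tren_tvup.
  - rewrite IHT2. f_equal. etransitivity; [apply tren_tvup|].
    apply (f_equal tvup). extensionality X. symmetry. apply tsub_tren.
Qed.

Lemma tvsub_tvup r r' :
  (fun X => tvsub (tvup r') (tvup r X)) = tvup (fun X => tvsub r' (r X)).
Proof.
  extensionality X. destruct X; [reflexivity|]. simpl. rewrite tvsub_tren, tren_tvsub. reflexivity.
Qed.

Lemma tvsub_tvunder n r r' :
  (fun X => tvsub (tvunder n r') (tvunder n r X)) = tvunder n (fun X => tvsub r' (r X)).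
Proof. extensionality X. symmetry. apply tsub_tvsub. Qed.

Lemma tvsub_tvsub r r' T : tvsub r' (tvsub r T) = tvsub (fun X => tvsub r' (r X)) T.
Proof.
  revert r r'; induction T; intros; simpl; f_equal; auto.
  - rewrite IHT1. f_equal. apply tvsub_tvunder.
  - rewrite IHT2. f_equal. apply tvsub_tvunder.
  - rewrite IHT. f_equal. apply tvsub_tvunder.
  - rewrite IHT. f_equal. apply tvsub_tvunder.
  - rewrite IHT. f_equal. apply tvsub_tvup.
  - rewrite IHT. f_equal. apply tvsub_tvup.
  - rewrite IHT2. f_equal. etransitivity; [apply tvsub_tvup|].
    exact (f_equal tvup (tvsub_tvunder 1 r r')).
Qed.

Lemma tvsub_tvone_tren R T : tvsub (tvone R) (tren S T) = T.
Proof. rewrite tvsub_tren. rewrite (tvsub_TVar (fun X => X)). apply tren_id. Qed.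

Lemma tvsub_tvup_tren r T : tvsub (tvup r) (tren S T) = tren S (tvsub r T).
Proof. rewrite tvsub_tren, tren_tvsub. reflexivity. Qed.

Lemma tvsub_tvunder_tsub n s r T :
  iseq (ishift n) s = @ivar I -> tsub s (tvsub (tvunder n r) T) = tvsub r (tsub s T).
Proof.
  intros Hs. rewrite tsub_tvsub. f_equal. extensionality X. unfold tvunder.
  rewrite tsub_tsub, Hs. apply tsub_ivar.
Qed.

(** The types inserted by [r] live outside the scope of the spine, so instantiation merely undoes
    their shift. *)
Lemma tvsub_ispine n Ms r T :
  length Ms = n -> tsub (ispine Ms) (tvsub (tvunder n r) T) = tvsub r (tsub (ispine Ms) T).
Proof. intros Hn. apply tvsub_tvunder_tsub, iseq_ishift_ispine, Hn. Qed.

Lemma tvsub_tshift n r T :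
  tvsub (tvunder n r) (tsub (ishift n) T) = tsub (ishift n) (tvsub r T).
Proof. symmetry. apply tsub_tvsub. Qed.

(** * Applied types *)

(** The condition on the image of [r] under which [tvsub r] commutes with [tapp]: at a head variable
    sent to a lambda, [tapp] would contract where [tvsub] builds a [TApp]. *)
Definition nonlam T : Prop := match T with TLam _ => False | _ => True end.

Lemma tsub_tlams s k T : tsub s (tlams k T) = tlams k (tsub (iupn k s) T).
Proof.
  revert s T; induction k as [|k IH]; intros; [reflexivity|].
  change (TLam (tsub (iup s) (tlams k T)) = TLam (tlams k (tsub (iupn (S k) s) T))).
  rewrite IH, iupn_iup. reflexivity.
Qed.

Lemma tvsub_tlams r k T : tvsub r (tlams k T) = tlams k (tvsub (tvunder k r) T).
Proof.
  revert r T; induction k as [|k IH]; intros; [rewrite tvunder_0; reflexivity|].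
  change (TLam (tvsub (tvunder 1 r) (tlams k T)) = TLam (tlams k (tvsub (tvunder (S k) r) T))).
  rewrite IH, tvunder_tvunder, PeanoNat.Nat.add_1_r. reflexivity.
Qed.

Lemma tlams_inj k T T' : tlams k T = tlams k T' -> T = T'.
Proof. induction k; simpl; intros H; [exact H | injection H; auto]. Qed.

Lemma tsub_tapp s T M : tsub s (tapp T M) = tapp (tsub s T) (isub s M).
Proof.
  destruct T; try reflexivity. cbn [tapp tsub].
  rewrite !tsub_tsub, (iseq_ispine (n := 1)); reflexivity.
Qed.

Lemma tsub_tapps s T Ms : tsub s (tapps T Ms) = tapps (tsub s T) (map (isub s) Ms).
Proof.
  revert T; induction Ms as [|M Ms IH]; intros T; [reflexivity|].
  cbn. etransitivity; [apply IH|]. rewrite tsub_tapp. reflexivity.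
Qed.

Lemma tvsub_tapp r T M : (forall X, nonlam (r X)) -> tvsub r (tapp T M) = tapp (tvsub r T) M.
Proof.
  intros Hr. destruct T; try reflexivity; cbn [tapp].
  - symmetry. apply tvsub_ispine. reflexivity.
  - specialize (Hr X). cbn. destruct (r X); try reflexivity. contradiction.
Qed.

Lemma tvsub_tapps r T Ms :
  (forall X, nonlam (r X)) -> tvsub r (tapps T Ms) = tapps (tvsub r T) Ms.
Proof.
  intros Hr. revert T; induction Ms as [|M Ms IH]; intros T; [reflexivity|].
  cbn. etransitivity; [apply IH|]. rewrite tvsub_tapp by exact Hr. reflexivity.
Qed.

(** Heads that [tapps] keeps recognizable: a lambda would be contracted, and an application would
    blur the border between head and spine. *)
Definition tneutral T : Prop :=
  match T with TLam _ | TApp _ _ => False | _ => True end.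

Lemma tapps_rcons T Ms M : tapps T (Ms ++ [M]) = tapp (tapps T Ms) M.
Proof. apply fold_left_app. Qed.

Lemma tapps_nonlam T Ms : nonlam T -> nonlam (tapps T Ms).
Proof.
  intros HT. induction Ms as [|M Ms IH] using rev_ind; [exact HT|].
  rewrite tapps_rcons. destruct (tapps T Ms); try exact IH. contradiction.
Qed.

Lemma tapps_rcons_neutral T Ms M : tneutral T -> tapps T (Ms ++ [M]) = TApp (tapps T Ms) M.
Proof.
  intros HT. rewrite tapps_rcons.
  assert (H : nonlam (tapps T Ms)) by (apply tapps_nonlam; destruct T; easy).
  destruct (tapps T Ms); try reflexivity. contradiction.
Qed.

(** Induction from the right end of the spine, because the last argument is the one under the
    outermost [TApp]. Spines of different lengths would equate a neutral head with an
    application. *)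
Lemma tapps_inj T T' Ms Ms' :
  tneutral T -> tneutral T' -> tapps T Ms = tapps T' Ms' -> T = T' /\ Ms = Ms'.
Proof.
  intros HT HT'. revert Ms'; induction Ms as [|M Ms IH] using rev_ind;
    intros Ms'; destruct Ms' as [|M' Ms' _] using rev_ind; intros H.
  - auto.
  - rewrite tapps_rcons_neutral in H by assumption. cbn in H. subst. contradiction.
  - rewrite tapps_rcons_neutral in H by assumption. cbn in H. subst. contradiction.
  - rewrite !tapps_rcons_neutral in H by assumption. injection H as H ->.
    apply IH in H as [-> ->]. auto.
Qed.

Lemma tsub_tinst s Ms R T :
  tsub s (tinst Ms R T) = tinst (map (isub s) Ms) (tsub s R) (tsub (iupn (length Ms) s) T).
Proof.
  unfold tinst. rewrite tsub_tvsub, !tsub_tsub, (iseq_ispine (n := length Ms)) by reflexivity.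
  f_equal. extensionality X. destruct X; reflexivity.
Qed.

Lemma tvsub_tinst r Ms R T :
  tvsub r (tinst Ms R T) = tinst Ms (tvsub r R) (tvsub (tvunder (length Ms) (tvup r)) T).
Proof.
  unfold tinst. rewrite tvsub_ispine by reflexivity. rewrite !tvsub_tvsub. f_equal.
  extensionality X. destruct X; [reflexivity|]. symmetry. apply tvsub_tvone_tren.
Qed.

Lemma tsub_tmu_app s K T Ms :
  tsub s (tmu_app K T Ms) = tmu_app (ksub s K) (tsub (iupn (length Ms) s) T) (map (isub s) Ms).
Proof. unfold tmu_app. rewrite tsub_tapps, length_map. cbn. rewrite tsub_tlams. reflexivity. Qed.

Lemma tsub_tnu_app s K T Ms :
  tsub s (tnu_app K T Ms) = tnu_app (ksub s K) (tsub (iupn (length Ms) s) T) (map (isub s) Ms).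
Proof. unfold tnu_app. rewrite tsub_tapps, length_map. cbn. rewrite tsub_tlams. reflexivity. Qed.

Lemma tsub_tmu_unfold s K T Ms :
  tsub s (tmu_unfold K T Ms) = tmu_unfold (ksub s K) (tsub (iupn (length Ms) s) T) (map (isub s) Ms).
Proof. unfold tmu_unfold. rewrite tsub_tinst, length_map. cbn. rewrite tsub_tlams. reflexivity. Qed.

Lemma tsub_tnu_unfold s K T Ms :
  tsub s (tnu_unfold K T Ms) = tnu_unfold (ksub s K) (tsub (iupn (length Ms) s) T) (map (isub s) Ms).
Proof. unfold tnu_unfold. rewrite tsub_tinst, length_map. cbn. rewrite tsub_tlams. reflexivity. Qed.

Lemma tsub_trec_suc s K T0 Ts N Ms :
  tsub s (trec_suc K T0 Ts N Ms) =
  trec_suc (ksub s K) (tsub s T0) (tsub (iup s) Ts) (isub s N) (map (isub s) Ms).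
Proof. unfold trec_suc. rewrite tsub_tapps, tsub_tinst. reflexivity. Qed.

Lemma tvsub_tmu_app r K T Ms :
  (forall X, nonlam (r X)) ->
  tvsub r (tmu_app K T Ms) = tmu_app K (tvsub (tvunder (length Ms) (tvup r)) T) Ms.
Proof.
  intros Hr. unfold tmu_app. rewrite tvsub_tapps by exact Hr. cbn. fold (tvup r).
  rewrite tvsub_tlams. reflexivity.
Qed.

Lemma tvsub_tnu_app r K T Ms :
  (forall X, nonlam (r X)) ->
  tvsub r (tnu_app K T Ms) = tnu_app K (tvsub (tvunder (length Ms) (tvup r)) T) Ms.
Proof.
  intros Hr. unfold tnu_app. rewrite tvsub_tapps by exact Hr. cbn. fold (tvup r).
  rewrite tvsub_tlams. reflexivity.
Qed.

Lemma tvsub_tmu_unfold r K T Ms :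
  tvsub r (tmu_unfold K T Ms) = tmu_unfold K (tvsub (tvunder (length Ms) (tvup r)) T) Ms.
Proof.
  unfold tmu_unfold. rewrite tvsub_tinst. cbn. fold (tvup r). rewrite tvsub_tlams. reflexivity.
Qed.

Lemma tvsub_tnu_unfold r K T Ms :
  tvsub r (tnu_unfold K T Ms) = tnu_unfold K (tvsub (tvunder (length Ms) (tvup r)) T) Ms.
Proof.
  unfold tnu_unfold. rewrite tvsub_tinst. cbn. fold (tvup r). rewrite tvsub_tlams. reflexivity.
Qed.

Lemma tvsub_trec_suc r K T0 Ts N Ms :
  (forall X, nonlam (r X)) ->
  tvsub r (trec_suc K T0 Ts N Ms) =
  trec_suc K (tvsub r T0) (tvsub (tvup (tvunder 1 r)) Ts) N Ms.
Proof.
  intros Hr. unfold trec_suc. rewrite tvsub_tapps, tvsub_tinst, tvunder_tvup by exact Hr. reflexivity.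
Qed.

Lemma nonlam_tsub s T : nonlam T -> nonlam (tsub s T).
Proof. destruct T; auto. Qed.

Lemma nonlam_tren f T : nonlam T -> nonlam (tren f T).
Proof. destruct T; auto. Qed.

Lemma nonlam_tvup r : (forall X, nonlam (r X)) -> forall X, nonlam (tvup r X).
Proof. intros Hr [|X]; [exact Logic.I|]. apply nonlam_tren, Hr. Qed.

End IndexCalculus.

(** * Kinding *)

Section Kinding.
Variable L : index_language.
Implicit Types (D : list (ity L)) (Xi : list (kind L)) (s : nat -> itm L).

Lemma ilookup_app E D i U :
  ilookup D i = Some U -> ilookup (E ++ D) (length E + i) = Some (itsub (@ishift L (length E)) U).
Proof.
  intros HU. induction E as [|V E IH]; cbn.
  - rewrite HU, ishift_0, itsub_id. reflexivity.
  - rewrite IH. cbn. rewrite itsub_iseq, iseq_ishift. reflexivity.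
Qed.

Lemma isub_ty_ishift E D : isub_ty (E ++ D) (@ishift L (length E)) D.
Proof. intros i U HU. apply ihas_var, ilookup_app, HU. Qed.

Lemma isub_ty_iup D' s D U : isub_ty D' s D -> isub_ty (itsub s U :: D') (iup s) (U :: D).
Proof.
  intros Hs [|i] V; cbn.
  - intros [= <-]. rewrite itsub_iseq, iseq_ishift_iup, <- itsub_iseq. apply ihas_var. reflexivity.
  - destruct (ilookup D i) as [W|] eqn:HW; [|discriminate]. intros [= <-].
    rewrite itsub_iseq, iseq_ishift_iup, <- itsub_iseq.
    apply ihas_sub with (D := D'); [apply (isub_ty_ishift [itsub s U])|]. apply Hs, HW.
Qed.

Lemma isub_ty_iupn D' s D Us :
  isub_ty D' s D ->
  isub_ty (rev (spsub s Us) ++ D') (iupn (length Us) s) (rev Us ++ D).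
Proof.
  revert D' s D; induction Us as [|U Us IH]; intros D' s D Hs; [exact Hs|].
  cbn [spsub rev length]. rewrite <- !app_assoc, <- iupn_iup. apply IH, isub_ty_iup, Hs.
Qed.

(** Looking up a variable shifts its type past the later entries of the context; extending the
    substitution by those entries cancels the shifts. *)
Lemma isub_ty_isubst_of D' th D : isubst_ty D' th D -> isub_ty D' (isubst_of th) D.
Proof.
  induction 1 as [|th D M U Hth IH HM]; intros i V; [destruct i; discriminate|].
  destruct i as [|i]; cbn.
  - intros [= <-]. rewrite itsub_iseq.
    change (isubst_of (M :: th)) with (scons M (isubst_of th)).
    rewrite iseq_ishift_scons. exact HM.
  - destruct (ilookup D i) as [W|] eqn:HW; [|discriminate]. intros [= <-]. rewrite itsub_iseq.
    change (isubst_of (M :: th)) with (scons M (isubst_of th)).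
    rewrite iseq_ishift_scons. apply IH, HW.
Qed.

Lemma spine_itype_sub D' s D Us :
  isub_ty D' s D -> spine_itype D Us -> spine_itype D' (spsub s Us).
Proof.
  intros Hs HUs. revert D' s Hs.
  induction HUs as [|D U Us HU _ IH]; intros D' s Hs; cbn; constructor.
  - exact (is_itype_sub Hs HU).
  - apply IH, isub_ty_iup, Hs.
Qed.

Lemma spine_ty_sub D' s D Ms (Us : list (ity L)) :
  isub_ty D' s D -> spine_ty D Ms Us -> spine_ty D' (map (isub s) Ms) (spsub s Us).
Proof.
  intros Hs. induction 1 as [|M Ms U Us HM _ IH]; cbn; constructor.
  - exact (ihas_sub Hs HM).
  - rewrite spsub_spsub, (iseq_ispine (n := 1)) in IH by reflexivity.
    rewrite spsub_spsub. exact IH.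
Qed.

Lemma spine_ty_length D Ms (Us : list (ity L)) : spine_ty D Ms Us -> length Ms = length Us.
Proof. induction 1; cbn in *; [reflexivity|]. rewrite length_spsub in *. auto. Qed.

(** A spine substitutes each argument into the remaining types, an environment accumulates the
    arguments. The induction moves one argument at a time from the spine to [th], and
    [iseq_iup_ispine] identifies the resulting types. *)
Lemma isubst_ty_spine th D Ns (Us : list (ity L)) :
  isubst_ty [] th D -> spine_ty [] Ns (spsub (isubst_of th) Us) ->
  isubst_ty [] (rev Ns ++ th) (rev Us ++ D).
Proof.
  revert th D Ns; induction Us as [|U Us IH]; intros th D Ns Hth HNs; inversion HNs; subst.
  - exact Hth.
  - cbn [rev]. rewrite <- !app_assoc. apply IH.
    + constructor; assumption.
    + rewrite spsub_spsub, iseq_iup_ispine in *. assumption.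
Qed.

Lemma kshift_map n s Xi :
  map (ksub (iupn n s)) (kshift n Xi) = kshift n (map (ksub s) Xi).
Proof.
  unfold kshift. rewrite !map_map. apply map_ext. intros K.
  rewrite !ksub_ksub, iseq_ishift_iupn. reflexivity.
Qed.

Lemma kshift_map1 s Xi : map (ksub (iup s)) (kshift 1 Xi) = kshift 1 (map (ksub s) Xi).
Proof. exact (kshift_map 1 s Xi). Qed.

Scheme kcheck_min := Minimality for kcheck Sort Prop
  with ksynth_min := Minimality for ksynth Sort Prop.
Combined Scheme kinding_min from kcheck_min, ksynth_min.

Lemma kinding_isub :
  (forall D Xi T K, kcheck D Xi T K -> forall D' s, isub_ty D' s D ->
     kcheck D' (map (ksub s) Xi) (tsub s T) (ksub s K)) /\
  (forall D Xi T K, ksynth D Xi T K -> forall D' s, isub_ty D' s D ->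
     ksynth D' (map (ksub s) Xi) (tsub s T) (ksub s K)).
Proof.
  apply kinding_min; cbn -[ispine]; intros.
  - constructor.
  - constructor; auto.
  - constructor; auto.
  - constructor; [eapply spine_itype_sub; eassumption| |];
      rewrite length_spsub, <- kshift_map; auto using isub_ty_iupn.
  - constructor; [exact (is_itype_sub H2 H)|]. rewrite <- kshift_map1.
    apply H1, isub_ty_iup, H2.
  - eapply kc_eq; [exact (ihas_sub H1 H) | exact (ihas_sub H1 H0)].
  - constructor. rewrite <- kshift_map1. apply H0, isub_ty_iup, H1.
  - apply kc_synth. auto.
  - constructor. rewrite nth_error_map, H. reflexivity.
  - rewrite ksub_ksub, (iseq_ispine (n := 1)), <- ksub_ksub by reflexivity.
    econstructor; [apply H0, H2 | exact (ihas_sub H2 H1)].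
  - constructor. apply H0, H1.
  - constructor. apply H0, H1.
  - rewrite itsub_nat. constructor.
    + specialize (H0 _ _ H3).
      rewrite ksub_ksub, (iseq_ispine (n := 1)), <- ksub_ksub in H0 by reflexivity.
      cbn in H0. rewrite isub_zero in H0. exact H0.
    + specialize (H2 _ _ (isub_ty_iup (U := inat) H3)).
      cbn [map] in H2. rewrite itsub_nat, kshift_map1, ksub_ksub in H2.
      rewrite ksub_ksub.
      (* Substituting [suc u] for [u] commutes with lifting: either way variable 0 goes to [suc u]
         and every other variable to the shift of its image under [s]. *)
      replace (iseq (iup s) (scons (isuc (ivar 0)) (@ishift L 1)))
        with (iseq (scons (isuc (ivar 0)) (@ishift L 1)) (iup s)); [exact H2|].
      extensionality i. unfold iseq. destruct i as [|i]; cbn.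
      * rewrite isub_suc, !isub_var. reflexivity.
      * rewrite isub_iseq. unfold ishift at 1. rewrite isub_var. cbn.
        rewrite iseq_ishift_scons. reflexivity.
Qed.

Lemma kcheck_isub D' s D Xi T K :
  isub_ty D' s D -> kcheck D Xi T K -> kcheck D' (map (ksub s) Xi) (tsub s T) (ksub s K).
Proof. intros Hs HT. exact (proj1 kinding_isub _ _ _ _ HT _ _ Hs). Qed.

Lemma ksynth_isub D' s D Xi T K :
  isub_ty D' s D -> ksynth D Xi T K -> ksynth D' (map (ksub s) Xi) (tsub s T) (ksub s K).
Proof. intros Hs HT. exact (proj2 kinding_isub _ _ _ _ HT _ _ Hs). Qed.

(** * Kinding under renaming and substitution of type variables *)

Definition tvren_ty Xi' (f : nat -> nat) Xi : Prop :=
  forall X K, nth_error Xi X = Some K -> nth_error Xi' (f X) = Some K.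

Lemma tvren_ty_map s Xi' f Xi :
  tvren_ty Xi' f Xi -> tvren_ty (map (ksub s) Xi') f (map (ksub s) Xi).
Proof.
  intros Hf X K. rewrite !nth_error_map.
  destruct (nth_error Xi X) as [K'|] eqn:HX; [|discriminate]. rewrite (Hf _ _ HX). auto.
Qed.

Lemma tvren_ty_upren Xi' f Xi K : tvren_ty Xi' f Xi -> tvren_ty (K :: Xi') (upren f) (K :: Xi).
Proof. intros Hf [|X] K'; [auto|]. apply Hf. Qed.

(** Precedes the substitution lemma because [tvup] renames the inserted types when passing a type
    binder. *)
Lemma kinding_tren :
  (forall D Xi T K, kcheck D Xi T K -> forall Xi' f, tvren_ty Xi' f Xi ->
     kcheck D Xi' (tren f T) K) /\
  (forall D Xi T K, ksynth D Xi T K -> forall Xi' f, tvren_ty Xi' f Xi ->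
     ksynth D Xi' (tren f T) K).
Proof.
  apply kinding_min; cbn -[ispine]; intros;
    econstructor; eauto using tvren_ty_map, tvren_ty_upren.
Qed.

Lemma ksynth_nonlam D Xi T K : ksynth D Xi T K -> nonlam T.
Proof. destruct 1; exact Logic.I. Qed.

(** [nonlam] is asked for every [X], since [tvsub_tapps] speaks of raw types of unknown scope. Kinds
    are synthesized, not checked, so that a replaced variable may stand at the head of an
    application. *)
Definition tvsub_ty D Xi' (r : nat -> ty L) Xi : Prop :=
  (forall X, nonlam (r X)) /\
  (forall X K, nth_error Xi X = Some K -> ksynth D Xi' (r X) K).

Lemma tvsub_ty_isub D' s D Xi' r Xi :
  isub_ty D' s D -> tvsub_ty D Xi' r Xi ->
  tvsub_ty D' (map (ksub s) Xi') (fun X => tsub s (r X)) (map (ksub s) Xi).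
Proof.
  intros Hs [Hn Hr]. split; [intros X; apply nonlam_tsub, Hn|].
  intros X K. rewrite nth_error_map.
  destruct (nth_error Xi X) as [K'|] eqn:HX; [|discriminate]. intros [= <-].
  eapply ksynth_isub; eauto.
Qed.

Lemma tvsub_ty_tvunder Us D Xi' r Xi :
  tvsub_ty D Xi' r Xi ->
  tvsub_ty (rev Us ++ D) (kshift (length Us) Xi') (tvunder (length Us) r) (kshift (length Us) Xi).
Proof. apply tvsub_ty_isub. rewrite <- length_rev. apply isub_ty_ishift. Qed.

Lemma tvsub_ty_tvup K D Xi' r Xi :
  tvsub_ty D Xi' r Xi -> tvsub_ty D (K :: Xi') (tvup r) (K :: Xi).
Proof.
  intros [Hn Hr]. split; [apply nonlam_tvup, Hn|]. intros [|X] K' HX.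
  - constructor. exact HX.
  - apply (proj2 kinding_tren) with (Xi := Xi'); [apply Hr, HX|]. intros Y K''. auto.
Qed.

Lemma kinding_tvsub :
  (forall D Xi T K, kcheck D Xi T K -> forall Xi' r, tvsub_ty D Xi' r Xi ->
     kcheck D Xi' (tvsub r T) K) /\
  (forall D Xi T K, ksynth D Xi T K -> forall Xi' r, tvsub_ty D Xi' r Xi ->
     ksynth D Xi' (tvsub r T) K).
Proof.
  apply kinding_min; cbn -[ispine]; intros.
  - constructor.
  - constructor; auto.
  - constructor; auto.
  - constructor; [assumption|apply H1|apply H3]; apply tvsub_ty_tvunder; assumption.
  - constructor; [assumption|]. apply H1, (tvsub_ty_tvunder [U]), H2.
  - econstructor; eassumption.
  - constructor. apply H0, (tvsub_ty_tvunder [U]), H1.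
  - apply kc_synth. auto.
  - apply H0. assumption.
  - econstructor; eauto.
  - constructor. apply H0, tvsub_ty_tvup, H1.
  - constructor. apply H0, tvsub_ty_tvup, H1.
  - constructor; [auto|]. apply H2, tvsub_ty_tvup, (tvsub_ty_tvunder [inat]), H3.
Qed.

Lemma kcheck_tvsub D Xi' r Xi T K : tvsub_ty D Xi' r Xi -> kcheck D Xi T K -> kcheck D Xi' (tvsub r T) K.
Proof. intros Hr HT. exact (proj1 kinding_tvsub _ _ _ _ HT _ _ Hr). Qed.

Lemma kcheck_TEq_inv D Xi M N K :
  kcheck D Xi (TEq M N) K -> exists U, ihas D M U /\ ihas D N U.
Proof.
  intros H. inversion H; subst; [eauto|].
  match goal with HT : ksynth _ _ _ _ |- _ => inversion HT end.
Qed.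

Lemma kcheck_TArr_inv D Xi Us A T K :
  kcheck D Xi (TArr Us A T) K ->
  spine_itype D Us /\
  kcheck (rev Us ++ D) (kshift (length Us) Xi) A KStar /\
  kcheck (rev Us ++ D) (kshift (length Us) Xi) T KStar.
Proof.
  intros H. inversion H; subst; [auto|].
  match goal with HT : ksynth _ _ _ _ |- _ => inversion HT end.
Qed.

(** Yields the kind of the recursive type in the rules for rec and corec from the kinding of its
    body under [Us]. *)
Lemma kcheck_tlams Us D Xi T :
  kcheck (rev Us ++ D) (kshift (length Us) Xi) T KStar ->
  kcheck D Xi (tlams (length Us) T) (kpis Us).
Proof.
  revert D Xi; induction Us as [|U Us IH]; intros D Xi; cbn.
  - unfold kshift. rewrite (map_ext _ (fun K => K)), map_id; [auto|]. apply ksub_ivar.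
  - rewrite <- app_assoc. intros HT. constructor. apply IH.
    unfold kshift in *. rewrite map_map.
    rewrite (map_ext _ (ksub (ishift (S (length Us))))); [exact HT|].
    intros K. rewrite ksub_ksub, iseq_ishift, PeanoNat.Nat.add_1_r. reflexivity.
Qed.

(** * Typing under type-variable substitution *)

Lemma tvsub_TSig (r : nat -> ty L) U T : tvsub r (TSig U T) = TSig U (tvsub (tvunder 1 r) T).
Proof. reflexivity. Qed.

Lemma tvsub_TArr (r : nat -> ty L) Us A T :
  tvsub r (TArr Us A T) =
  TArr Us (tvsub (tvunder (length Us) r) A) (tvsub (tvunder (length Us) r) T).
Proof. reflexivity. Qed.

Lemma tvsub_TMu (r : nat -> ty L) K T : tvsub r (TMu K T) = TMu K (tvsub (tvup r) T).
Proof. reflexivity. Qed.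

Lemma tvsub_TNu (r : nat -> ty L) K T : tvsub r (TNu K T) = TNu K (tvsub (tvup r) T).
Proof. reflexivity. Qed.

Lemma tvsub_TRec (r : nat -> ty L) K T0 Ts :
  tvsub r (TRec K T0 Ts) = TRec K (tvsub r T0) (tvsub (tvup (tvunder 1 r)) Ts).
Proof. reflexivity. Qed.

Scheme check_min := Minimality for check Sort Prop
  with synth_min := Minimality for synth Sort Prop
  with check_rule_min := Minimality for check_rule Sort Prop
  with synth_rule_min := Minimality for synth_rule Sort Prop.
Combined Scheme typing_min from check_min, synth_min, check_rule_min, synth_rule_min.

Lemma check_presup D Xi G t T : check D Xi G t T -> presup D Xi G T.
Proof. destruct 1; assumption. Qed.

Lemma synth_presup D Xi G t T : synth D Xi G t T -> presup D Xi G T.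
Proof. destruct 1; assumption. Qed.

Lemma eren_eren f g (t : tm L) : eren f (eren g t) = eren (fun X => f (g X)) t.
Proof. induction t; cbn; rewrite ?tren_tren; f_equal; auto. Qed.

Lemma eren_id (t : tm L) : eren (fun X => X) t = t.
Proof. induction t; cbn; rewrite ?tren_id; f_equal; auto. Qed.

Lemma map_tvsub_tshift n (r : nat -> ty L) G :
  map (tvsub (tvunder n r)) (cshift n G) = cshift n (map (tvsub r) G).
Proof. unfold cshift. rewrite !map_map. apply map_ext. intros T. apply tvsub_tshift. Qed.

Lemma map_tvsub_tren (r : nat -> ty L) G :
  map (tvsub (tvup r)) (map (tren S) G) = map (tren S) (map (tvsub r) G).
Proof. rewrite !map_map. apply map_ext. intros T. apply tvsub_tvup_tren. Qed.

Lemma map_tsub_tvsub s (r : nat -> ty L) G :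
  map (tsub s) (map (tvsub r) G) = map (tvsub (fun X => tsub s (r X))) (map (tsub s) G).
Proof. rewrite !map_map. apply map_ext. intros T. apply tsub_tvsub. Qed.

Lemma tvsub_tapps_TVar0 (r : nat -> ty L) n Ms :
  (forall X, nonlam (r X)) ->
  tvsub (tvunder n (tvup r)) (tapps (TVar 0) Ms) = tapps (TVar 0) Ms.
Proof.
  intros Hr. rewrite tvsub_tapps; [reflexivity|].
  intros X. apply nonlam_tsub, nonlam_tvup, Hr.
Qed.

(** The unifier is only known to be well typed for sides of a common index type; that type comes
    from the presupposition that [TEq M N] is well-kinded. *)
Lemma synth_unify_isubst D Xi G t M N D' Th :
  synth D Xi G t (TEq M N) -> iunify D M N (Some (D', Th)) -> isubst_ty D' Th D.
Proof.
  intros Ht Hu. destruct (synth_presup Ht) as (_ & _ & _ & HT).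
  destruct (kcheck_TEq_inv HT) as (U & HM & HN). exact (proj1 (proj1 (iunify_mgu HM HN Hu))).
Qed.

(* The term is [eren f t0] for an arbitrary [f] with [r (f X)] a variable: the annotations of [t0] are
   then merely renamed, so that no substitution operation on terms is needed.  With [f := S] this
   covers the bodies of rec and corec. *)
Definition tvsub_stable (P : list (ity L) -> list (kind L) -> list (ty L) -> tm L -> ty L -> Prop)
    D Xi G (t : tm L) T : Prop :=
  forall Xi' r f g t0,
    t = eren f t0 -> (forall X, r (f X) = TVar (g X)) -> tvsub_ty D Xi' r Xi -> incl Xi' Xi ->
    P D Xi' (map (tvsub r) G) (eren g t0) (tvsub r T).

(** The inclusion transfers well-formedness of kinds: each kind in [Xi'] already occurs in [Xi]. *)
Lemma presup_tvsub D Xi' r Xi G T :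
  tvsub_ty D Xi' r Xi -> incl Xi' Xi -> presup D Xi G T ->
  presup D Xi' (map (tvsub r) G) (tvsub r T).
Proof.
  intros Hr Hi (HD & HXi & HG & HT). repeat split.
  - exact HD.
  - exact (incl_Forall Hi HXi).
  - rewrite Forall_map. revert HG. apply Forall_impl. intros A. apply kcheck_tvsub, Hr.
  - exact (kcheck_tvsub Hr HT).
Qed.

Lemma tvsub_tren_eq (r : nat -> ty L) f g T :
  (forall X, r (f X) = TVar (g X)) -> tvsub r (tren f T) = tren g T.
Proof.
  intros Hfg. rewrite tvsub_tren, <- tvsub_TVar. f_equal. extensionality X. apply Hfg.
Qed.

Lemma typing_tvsub :
  (forall D Xi G t T, check D Xi G t T -> tvsub_stable (@check L) D Xi G t T) /\
  (forall D Xi G t T, synth D Xi G t T -> tvsub_stable (@synth L) D Xi G t T) /\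
  (forall D Xi G t T, check_rule D Xi G t T -> tvsub_stable (@check_rule L) D Xi G t T) /\
  (forall D Xi G t T, synth_rule D Xi G t T -> tvsub_stable (@synth_rule L) D Xi G t T).
Proof.
  apply typing_min; unfold tvsub_stable.
  1-2: intros; constructor; [eapply presup_tvsub; eassumption | eauto].
  (* This rule puts no constraint on the shape of the term, so it is settled before [t0] is taken
     apart. *)
  all: try (intros; apply c_synth; eauto; fail).
  all: intros; match goal with E : _ = eren _ ?t0 |- _ =>
         destruct t0; try discriminate E; try (injection E; intros; subst); clear E end.
  all: cbn [eren].
  all: match goal with
         A : tvsub_ty _ _ ?r _, B : forall X, ?r _ = TVar _, C : incl _ _ |- _ =>
           pose proof (proj1 A) as Hn; rename A into Hr, B into Hfg, C into Hi end.
  all: try (cbn [tvsub]; econstructor; eauto; fail).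
  all: rewrite ?tvsub_TSig, ?tvsub_TArr, ?tvsub_tmu_app, ?tvsub_tapps, ?tvsub_TRec by assumption.
  - econstructor; [eassumption|]. rewrite tvsub_ispine by reflexivity. eauto.
  - econstructor; [eauto|]. unfold tshift. rewrite <- map_tvsub_tshift, <- tvsub_tshift.
    eapply (H2 _ (tvunder 1 r)); [reflexivity| | |].
    + intros X. unfold tvunder. rewrite Hfg. reflexivity.
    + apply (tvsub_ty_tvunder [U]), Hr.
    + apply incl_map, Hi.
  - econstructor; [eapply (H0 _ r); eauto | eassumption|].
    rewrite map_tsub_tvsub, tsub_tvsub.
    eapply (H3 _ (fun X => tsub _ (r X))); [reflexivity| | |].
    + intros X. rewrite Hfg. reflexivity.
    (* The inserted types must follow the passage from [D] to [D'] along [Th]. *)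
    + apply tvsub_ty_isub with (D := D); [|exact Hr].
      eapply isub_ty_isubst_of, synth_unify_isubst; eassumption.
    + apply incl_map, Hi.
  - econstructor. rewrite <- map_tvsub_tshift.
    eapply (H0 _ (tvunder (length Us) r)); [reflexivity| | |].
    + intros X. unfold tvunder. rewrite Hfg. reflexivity.
    + apply tvsub_ty_tvunder, Hr.
    + apply incl_map, Hi.
  - econstructor. rewrite <- tvsub_tmu_unfold. eauto.
  - rewrite tvsub_tapps by (intros X; apply nonlam_tsub, Hn).
    unfold tshift. rewrite tvsub_tshift, tvsub_TMu, tvsub_tlams, tvunder_tvup. econstructor.
    rewrite eren_eren in H0.
    (* Below the new [X] the term is renamed by [f] and then by [S], and the result is to be renamed
       by [g] and then by [S]. The generality of [f] and [g] in [tvsub_stable] is what lets the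
       hypothesis apply here. *)
    specialize (H0 (kpis Us :: Xi') (tvup r) _ (fun X => S (g X)) _ eq_refl).
    rewrite <- (eren_eren S g), tvsub_TArr in H0. cbn [map] in H0.
    rewrite tvsub_TArr, tvsub_tapps_TVar0, map_tvsub_tren, tvunder_tvup, !tvsub_tvup_tren in H0
      by assumption.
    apply H0.
    + intros X. cbn. rewrite Hfg. reflexivity.
    + apply tvsub_ty_tvup, Hr.
    + apply incl_cons; [left; reflexivity | apply incl_tl, Hi].
  - rewrite tvsub_tapps by (intros X; apply nonlam_tsub, Hn).
    unfold tshift. rewrite tvsub_tshift, tvsub_TNu, tvsub_tlams, tvunder_tvup. econstructor.
    rewrite eren_eren in H0.
    specialize (H0 (kpis Us :: Xi') (tvup r) _ (fun X => S (g X)) _ eq_refl).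
    rewrite <- (eren_eren S g), tvsub_TArr in H0. cbn [map] in H0.
    rewrite tvsub_TArr, tvsub_tapps_TVar0, map_tvsub_tren, tvunder_tvup, !tvsub_tvup_tren in H0
      by assumption.
    apply H0.
    + intros X. cbn. rewrite Hfg. reflexivity.
    + apply tvsub_ty_tvup, Hr.
    + apply incl_cons; [left; reflexivity | apply incl_tl, Hi].
  - econstructor.
    + rewrite tvsub_ispine by reflexivity. eauto.
    + rewrite tsub_tvsub.
      (* The inserted types do not mention [u], so replacing [u] by [suc u] leaves them as they
         are. *)
      replace (fun X => tsub _ (tvunder _ r X)) with (tvunder 1 r).
      2:{ extensionality X. unfold tvunder. cbn [length].
          rewrite tsub_tsub, iseq_ishift_scons. reflexivity. }
      rewrite <- map_tvsub_tshift. eapply (H2 _ (tvunder 1 r)); [reflexivity| | |].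
      * intros X. unfold tvunder. rewrite Hfg. reflexivity.
      * apply (tvsub_ty_tvunder [inat]), Hr.
      * apply incl_map, Hi.
  - econstructor. rewrite <- tvsub_tapps by assumption. eauto.
  - econstructor. rewrite <- tvsub_trec_suc by assumption. eauto.
  - constructor. rewrite nth_error_map, H. reflexivity.
  - rewrite <- (tvsub_ispine (n := length Us)) by (eapply spine_ty_length; eassumption).
    specialize (H0 Xi' r f g _ eq_refl Hfg Hr Hi). rewrite tvsub_TArr in H0.
    econstructor; [exact H0 | assumption|].
    rewrite tvsub_ispine by (eapply spine_ty_length; eassumption). eauto.
  - eapply s_out_zero. specialize (H0 Xi' r f g _ eq_refl Hfg Hr Hi).
    rewrite tvsub_tapps, tvsub_TRec in H0 by assumption. exact H0.
  - rewrite tvsub_trec_suc by assumption. constructor.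
    specialize (H0 Xi' r f g _ eq_refl Hfg Hr Hi).
    rewrite tvsub_tapps, tvsub_TRec in H0 by assumption. exact H0.
  - rewrite tvsub_tnu_unfold. constructor. rewrite <- tvsub_tnu_app by assumption. eauto.
  - rewrite (tvsub_tren_eq _ Hfg). constructor. rewrite <- (tvsub_tren_eq _ Hfg). eauto.
Qed.

(** [tvone R] sends [S X] to [TVar X], so with [f := S] the renaming [g] is the identity and [t]
    keeps its annotations. *)
Lemma check_tvone D Xi G R K t T :
  ksynth D Xi R K -> check D (K :: Xi) G (eren S t) T ->
  check D Xi (map (tvsub (tvone R)) G) t (tvsub (tvone R) T).
Proof.
  intros HR Ht. rewrite <- (eren_id t).
  apply (proj1 typing_tvsub _ _ _ _ _ Ht) with (f := S); [reflexivity..| | apply incl_tl, incl_refl].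
  split.
  - intros [|X]; [exact (ksynth_nonlam HR) | exact Logic.I].
  - intros [|X] K' HX; cbn in HX.
    + injection HX as <-. exact HR.
    + constructor. exact HX.
Qed.

End Kinding.

(** * Subject reduction *)

Section SubjectReduction.
Variable L : index_language.
Implicit Types (D : list (ity L)) (Xi : list (kind L)) (s : nat -> itm L).

(** * Unrolling recursive and corecursive definitions *)

Lemma tvone_tvunder_tren n (R T : ty L) : tvsub (tvunder n (tvone R)) (tren S T) = T.
Proof. rewrite tvsub_tren. etransitivity; [apply (tvsub_TVar (fun X => X)) | apply tren_id]. Qed.

Lemma map_tvone_tren (R : ty L) G : map (tvsub (tvone R)) (map (tren S) G) = G.
Proof. rewrite map_map. etransitivity; [|apply map_id]. apply map_ext, tvsub_tvone_tren. Qed.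

Lemma tvone_tapps_TVar0 D Xi K n (R : ty L) Ms :
  ksynth D Xi R K ->
  tvsub (tvunder n (tvone R)) (tapps (TVar 0) Ms) = tapps (tshift n R) Ms.
Proof.
  intros HR. rewrite tvsub_tapps; [reflexivity|].
  intros X. apply nonlam_tsub. destruct X; [exact (ksynth_nonlam HR) | exact Logic.I].
Qed.

(** After the replacement, the type of [f] is exactly the one that [c_rec] concludes for [ERec t],
    so the closure of [ERec t] can be stored for [f]. *)
Lemma rec_body D Xi G t Us A T :
  check D (kpis Us :: Xi)
        (TArr Us (tapps (TVar 0) (ivars (length Us))) (tren S T) :: map (tren S) G)
        (eren S t) (TArr Us A (tren S T)) ->
  let R := TMu (kpis Us) (tlams (length Us) A) in
  check D Xi (TArr Us (tapps (tshift (length Us) R) (ivars (length Us))) T :: G) t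
        (TArr Us (tvsub (tvunder (length Us) (tvone R)) A) T).
Proof.
  intros Ht R. destruct (check_presup Ht) as (_ & _ & _ & HT).
  assert (HR : ksynth D Xi R (kpis Us)).
  { constructor. apply kcheck_tlams. apply kcheck_TArr_inv in HT. apply HT. }
  apply (check_tvone HR) in Ht. cbn [map] in Ht.
  rewrite !tvsub_TArr, map_tvone_tren, (tvone_tapps_TVar0 _ _ HR), !tvone_tvunder_tren in Ht.
  exact Ht.
Qed.

Lemma corec_body D Xi G t Us A T :
  check D (kpis Us :: Xi)
        (TArr Us (tren S A) (tapps (TVar 0) (ivars (length Us))) :: map (tren S) G)
        (eren S t) (TArr Us (tren S A) T) ->
  let R := TNu (kpis Us) (tlams (length Us) T) in
  check D Xi (TArr Us A (tapps (tshift (length Us) R) (ivars (length Us))) :: G) t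
        (TArr Us A (tvsub (tvunder (length Us) (tvone R)) T)).
Proof.
  intros Ht R. destruct (check_presup Ht) as (_ & _ & _ & HT).
  assert (HR : ksynth D Xi R (kpis Us)).
  { constructor. apply kcheck_tlams. apply kcheck_TArr_inv in HT. apply HT. }
  apply (check_tvone HR) in Ht. cbn [map] in Ht.
  rewrite !tvsub_TArr, map_tvone_tren, (tvone_tapps_TVar0 _ _ HR), !tvone_tvunder_tren in Ht.
  exact Ht.
Qed.

Lemma tsub_ispine_iupn n Ns th (T : ty L) :
  length Ns = n ->
  tsub (ispine Ns) (tsub (iupn n (isubst_of th)) T) = tsub (isubst_of (rev Ns ++ th)) T.
Proof. intros Hn. rewrite tsub_tsub, iseq_iupn_ispine by exact Hn. reflexivity. Qed.

Lemma tsub_tshift_spine n Ns th (T : ty L) :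
  length Ns = n -> tsub (isubst_of (rev Ns ++ th)) (tshift n T) = tsub (isubst_of th) T.
Proof.
  intros Hn. unfold tshift, isubst_of.
  rewrite tsub_tsub, iext_app, iseq_ishift_iext; [reflexivity|]. rewrite length_rev. exact Hn.
Qed.

Lemma map_tsub_cshift n Ns th (G : list (ty L)) :
  length Ns = n ->
  map (tsub (isubst_of (rev Ns ++ th))) (cshift n G) = map (tsub (isubst_of th)) G.
Proof.
  intros Hn. unfold cshift. rewrite map_map. apply map_ext. intros T.
  apply tsub_tshift_spine, Hn.
Qed.

(** Matches the type from the unrolled body, closed by the extended environment, with the unfolding
    used in value typing. *)
Lemma tsub_tvunder_tvone n Ns th (R T : ty L) :
  length Ns = n ->
  tsub (isubst_of (rev Ns ++ th)) (tvsub (tvunder n (tvone R)) T) =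
  tinst Ns (tsub (isubst_of th) R) (tsub (iupn n (isubst_of th)) T).
Proof.
  intros Hn. rewrite <- (tsub_ispine_iupn _ _ Hn), tsub_tvsub, tsub_iupn_tvunder.
  rewrite tvsub_ispine by exact Hn. unfold tinst. f_equal.
  extensionality X. destruct X; reflexivity.
Qed.

Lemma tsub_tapps_ivars n Ns th (R : ty L) :
  length Ns = n ->
  tsub (isubst_of (rev Ns ++ th)) (tapps (tshift n R) (ivars n)) = tapps (tsub (isubst_of th) R) Ns.
Proof.
  intros Hn. rewrite tsub_tapps. unfold tshift. rewrite tsub_tsub.
  unfold isubst_of. rewrite iext_app, map_ivars_iext, iseq_ishift_iext; [reflexivity| |exact Hn].
  rewrite length_rev. exact Hn.
Qed.

(** * Inversion of typing and of value typing *)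

Definition synthesizing (t : tm L) : bool :=
  match t with
  | EVar _ | EApp _ _ _ | EOut _ _ | EOutNu _ | EAnn _ _ => true
  | _ => false
  end.

(** Apart from [c_synth] the rules are directed by the head of the term, so both judgments reduce to
    a single rule to be inverted. *)
Lemma typing_rule D Xi G t T :
  check D Xi G t T \/ synth D Xi G t T ->
  presup D Xi G T /\
  if synthesizing t then synth_rule D Xi G t T else check_rule D Xi G t T.
Proof.
  assert (Hsynth : synth D Xi G t T -> presup D Xi G T /\ synth_rule D Xi G t T /\ synthesizing t = true).
  { destruct 1 as [? ? ? ? ? Hp Hr]. repeat split; try assumption; try apply Hp. destruct Hr; reflexivity. }
  intros [Ht|Ht].
  - inversion Ht as [? ? ? ? ? Hp Hr]; subst. split; [exact Hp|].
    destruct (synthesizing t) eqn:E; [|exact Hr].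
    inversion Hr; subst; try discriminate E. apply Hsynth. assumption.
  - destruct (Hsynth Ht) as (Hp & Hr & ->). auto.
Qed.

Lemma kcheck_closed th D G (T : ty L) :
  isubst_ty [] th D -> presup D [] G T -> kcheck [] [] (tsub (isubst_of th) T) KStar.
Proof.
  intros Hth (_ & _ & _ & HT). exact (kcheck_isub (isub_ty_isubst_of Hth) HT).
Qed.

Lemma val_ty_rule (v : val L) T : val_ty v T -> val_rule v T.
Proof. destruct 1. assumption. Qed.

(** Closures are typed only by [v_clo], at a type [tsub _ T0]; index substitution keeps the
    outermost constructor, so [T0] is itself an arrow. *)
Lemma closure_inv g th sg Us A T :
  val_ty (VClo g th sg) (TArr Us A T) ->
  exists D G Us' A' T',
    isubst_ty [] th D /\ env_ty sg (map (tsub (isubst_of th)) G) /\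
    check D [] G g (TArr Us' A' T') /\ Us = spsub (isubst_of (I := L) th) Us' /\
    A = tsub (iupn (length Us') (isubst_of th)) A' /\
    T = tsub (iupn (length Us') (isubst_of th)) T'.
Proof.
  intros H%val_ty_rule. inversion H as [? ? ? D G T0 _ Hth Hsg Hg E1 E2| | | | | | | | | |].
  destruct T0; try discriminate. injection E2 as <- <- <-. exists D, G, Us0, T0_1, T0_2. auto 10.
Qed.

Lemma val_in_zero_inv (v : val L) K T0 Ts Ms :
  val_ty (VIn LZero v) (tapps (TRec K T0 Ts) (izero :: Ms)) -> val_ty v (tapps T0 Ms).
Proof.
  intros H%val_ty_rule. remember (tapps _ _) as A eqn:EA. inversion H; subst.
  match goal with EQ : @eq (ty _) _ _ |- _ => rename EQ into E end.
  apply tapps_inj in E as [[= -> -> ->] [= ->]]; try exact Logic.I. assumption.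
Qed.

Lemma val_in_suc_inv (v : val L) K T0 Ts N Ms :
  val_ty (VIn LSuc v) (tapps (TRec K T0 Ts) (isuc N :: Ms)) -> val_ty v (trec_suc K T0 Ts N Ms).
Proof.
  intros H%val_ty_rule. remember (tapps _ _) as A eqn:EA. inversion H; subst.
  match goal with EQ : @eq (ty _) _ _ |- _ => rename EQ into E end.
  apply tapps_inj in E as [[= -> -> ->] [= HN%isuc_inj ->]]; try exact Logic.I.
  rewrite <- HN. assumption.
Qed.

Lemma val_in_mu_inv (v : val L) K T Ms :
  val_ty (VInMu v) (tmu_app K T Ms) -> val_ty v (tmu_unfold K T Ms).
Proof.
  intros H%val_ty_rule. remember (tmu_app _ _ _) as A eqn:EA. inversion H; subst.
  match goal with EQ : @eq (ty _) _ _ |- _ => rename EQ into E end.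
  apply tapps_inj in E as [[= -> HT] ->]; try exact Logic.I.
  (* The spines have been equated, hence both bodies lie under the same number of lambdas. *)
  apply tlams_inj in HT as ->. assumption.
Qed.

Lemma env_ty_nth (sg : list (val L)) G x v T :
  env_ty sg G -> nth_error sg x = Some v -> nth_error G x = Some T -> val_ty v T.
Proof.
  intros Hsg. revert x. induction Hsg as [|sg G w A Hsg IH Hw]; intros [|x]; cbn; try discriminate.
  - intros [= <-] [= <-]. exact Hw.
  - apply IH.
Qed.

(** The index language provides only the introduction rule for [isuc]; for closed terms its inverse
    follows from the characterization by numerals. *)
Lemma ihas_isuc_inv (N : itm L) : ihas [] (isuc N) inat -> ihas [] N inat.
Proof.
  intros H. apply ihas_nat_closed in H as [[|n] Hn]; cbn in Hn.
  - symmetry in Hn. destruct (izero_isuc Hn).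
  - apply ihas_nat_closed. exists n. exact (isuc_inj Hn).
Qed.

Lemma function_value_check D Xi G g (T : ty L) :
  function_value g -> check D Xi G g T \/ synth D Xi G g T -> check D Xi G g T.
Proof.
  intros Hg [Ht|Ht]; [exact Ht|]. inversion Ht as [? ? ? ? ? _ Hr]; subst.
  inversion Hr; subst; contradiction.
Qed.

(* The simultaneous induction *)
Scheme eval_min := Minimality for eval Sort Prop
  with apply_min := Minimality for apply Sort Prop
  with out_nu_min := Minimality for out_nu Sort Prop.
Combined Scheme evaluation_min from eval_min, apply_min, out_nu_min.

Definition eval_sound (t : tm L) th sg v : Prop :=
  forall D G T, check D [] G t T \/ synth D [] G t T -> isubst_ty [] th D ->
    env_ty sg (map (tsub (isubst_of th)) G) -> val_ty v (tsub (isubst_of th) T).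

Definition apply_sound (c : val L) Ns v w : Prop :=
  forall Us A T, val_ty c (TArr Us A T) -> spine_ty [] Ns Us ->
    val_ty v (tsub (ispine Ns) A) -> val_ty w (tsub (ispine Ns) T).

Definition out_nu_sound (c w : val L) : Prop :=
  forall K T Ms, val_ty c (tnu_app K T Ms) -> val_ty w (tnu_unfold K T Ms).

(** The second part discards [c_synth] for terms whose head no synthesis rule covers. *)
Ltac inv_rule Hr :=
  inversion Hr; subst; clear Hr;
  try match goal with Hs : synth _ _ _ _ _ |- _ =>
    let Hr' := fresh in now inversion Hs as [? ? ? ? ? _ Hr']; inversion Hr'
  end.

Ltac head_value IH Hth Hsg :=
  match goal with Hs : synth _ _ _ _ _ |- _ =>
    pose proof (IH _ _ _ (or_intror Hs) Hth Hsg) as Hv; cbn [tsub] in Hv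
  end.

Lemma evaluation_sound :
  (forall t th sg v, eval t th sg v -> eval_sound t th sg v) /\
  (forall c Ns v w, apply c Ns v w -> apply_sound c Ns v w) /\
  (forall c w, out_nu c w -> out_nu_sound c w).
Proof.
  apply evaluation_min; unfold eval_sound, apply_sound, out_nu_sound.
  1-19: intros; match goal with Ht : check _ _ _ _ _ \/ _, A : isubst_ty _ _ _, B : env_ty _ _ |- _ =>
     rename Ht into Ht', A into Hth, B into Hsg; pose proof (typing_rule Ht') as [Hp Hr];
     cbn [synthesizing] in Hr; pose proof (kcheck_closed Hth Hp) as HK end.
  (* The closure of a function value stores the typing derivation whole, so this case must precede
     the inversion of the rule. *)
  4: { constructor; [exact HK|].
    econstructor; [assumption | exact Hth | exact Hsg | exact (function_value_check H Ht')]. }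
  1-18: clear Ht'; inv_rule Hr.
  - eapply env_ty_nth; [exact Hsg | eassumption |]. rewrite nth_error_map.
    match goal with HG : nth_error G _ = _ |- _ => rewrite HG end. reflexivity.
  - constructor; [exact HK | constructor].
  - constructor; [exact HK | constructor]. match goal with HE : ieq _ _ _ |- _ => rewrite HE end.
    reflexivity.
  - constructor; [exact HK|]. constructor; eauto.
  - constructor; [exact HK|]. constructor; eauto.
  - constructor; [exact HK|]. constructor; eauto.
  - rewrite tsub_tmu_app in *. constructor; [exact HK|]. constructor.
    rewrite <- tsub_tmu_unfold. eauto.
  - rewrite tsub_tapps in *. cbn [map tsub] in *. rewrite isub_zero in *.
    constructor; [exact HK|]. constructor. rewrite <- tsub_tapps. eauto.
  - rewrite tsub_tapps in *. cbn [map tsub] in *. rewrite isub_suc in *.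
    constructor; [exact HK|]. constructor. rewrite <- tsub_trec_suc. eauto.
  - constructor; [exact HK|]. constructor.
    + eapply ihas_sub; [eapply isub_ty_isubst_of|]; eassumption.
    + change (iup (isubst_of th)) with (iupn 1 (isubst_of th)).
      rewrite tsub_tsub, <- (iseq_ispine (Ms := [M]) (n := 1)), <- tsub_tsub by reflexivity. eauto.
  - eauto.
  - head_value H0 Hth Hsg. apply val_ty_rule in Hv. inversion Hv; subst.
    eapply H2; [left; eassumption | exact Hth |]. cbn [map]. repeat (constructor; [|assumption]). assumption.
  - head_value H0 Hth Hsg. apply val_ty_rule in Hv. inversion Hv; subst.
    eapply H2; [left; eassumption | exact Hth |]. cbn [map]. constructor; assumption.
  - head_value H0 Hth Hsg. apply val_ty_rule in Hv. inversion Hv; subst.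
    eapply H2; [left; eassumption | exact Hth |]. cbn [map]. constructor; assumption.
  - head_value H0 Hth Hsg. apply val_ty_rule in Hv. inversion Hv; subst.
    (* The result type does not depend on the unpacked index, so it may be read as its own shift in
       the environment extended by [N]. *)
    rewrite <- (tsub_tshift_spine (n := 1) (Ns := [N]) th T) by reflexivity.
    eapply H2; [left; eassumption | constructor; assumption |].
    cbn [map]. constructor.
    + rewrite (map_tsub_cshift (n := 1) (Ns := [N]) th G eq_refl : map (tsub (isubst_of (N :: th))) _ = _).
      exact Hsg.
    + rewrite tsub_tsub, iseq_iup_ispine in *. assumption.
  - head_value H0 Hth Hsg. apply val_ty_rule in Hv. inversion Hv; subst.
    match goal with Hs : synth _ _ _ _ _, Hu : iunify _ _ _ _ |- _ =>
      destruct (imatch_sound (synth_unify_isubst Hs Hu) H1) as [Hth' <-] end.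
    rewrite isubst_of_icomp in *. rewrite <- tsub_tsub.
    eapply H3; [left; eassumption | exact Hth' |].
    rewrite map_map. erewrite map_ext; [exact Hsg|]. intros A. apply tsub_tsub.
  - head_value H0 Hth Hsg.
    rewrite tsub_tapps in *. cbn [map tsub] in Hv. rewrite isub_zero in Hv.
    exact (val_in_zero_inv Hv).
  - head_value H0 Hth Hsg.
    rewrite tsub_tapps in Hv. cbn [map tsub] in Hv. rewrite isub_suc in Hv.
    rewrite tsub_trec_suc. exact (val_in_suc_inv Hv).
  - head_value H0 Hth Hsg. rewrite tsub_tnu_app in Hv. rewrite tsub_tnu_unfold. auto.
  - head_value H0 Hth Hsg.
    match goal with HMs : spine_ty _ _ _ |- _ =>
      pose proof (spine_ty_length HMs) as Hn;
      pose proof (spine_ty_sub (isub_ty_isubst_of Hth) HMs) as HMs' end.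
    (* Instantiating and then closing becomes closing under the binders and then instantiating with
       closed arguments, the form required by [apply_sound]. *)
    rewrite tsub_tsub, (iseq_ispine (n := length Us)), <- tsub_tsub by exact Hn.
    eapply H4; [exact Hv | exact HMs' |].
    rewrite tsub_tsub, <- (iseq_ispine (n := length Us)), <- tsub_tsub by exact Hn.
    eauto.
  - intros k t th sg Ns v w Hk _ IH Us A T Hc HNs Hv.
    apply closure_inv in Hc as (D & G & Us' & A' & T' & Hth & Hsg & Ht & -> & -> & ->).
    pose proof (spine_ty_length HNs) as Hn. rewrite length_spsub in Hn.
    destruct (typing_rule (or_introl Ht)) as [_ Hr]. inv_rule Hr.
    rewrite tsub_ispine_iupn in * by exact Hn.
    eapply IH; [left; eassumption | exact (isubst_ty_spine Hth HNs) |].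
    cbn [map]. constructor; [|exact Hv]. rewrite map_tsub_cshift by exact Hn. exact Hsg.
  - intros t th sg Ns v c w _ IHt _ IHc Us A T Hc HNs Hv. pose proof Hc as Hc'.
    apply closure_inv in Hc as (D & G & Us' & A' & T' & Hth & Hsg & Ht & -> & -> & ->).
    pose proof (spine_ty_length HNs) as Hn. rewrite length_spsub in Hn.
    destruct (typing_rule (or_introl Ht)) as [_ Hr]. inv_rule Hr.
    match goal with Hb : check _ _ _ (eren S t) _ |- _ => apply rec_body in Hb; rename Hb into Hb' end.
    (* The value stored for [f] is the closure being applied, typed by the copy [Hc'] made before
       inversion. *)
    assert (HtT := IHt _ _ _ (or_introl Hb') Hth (env_cons Hsg Hc')).
    eapply IHc; [exact HtT | exact HNs |].
    rewrite tsub_ispine_iupn in * by exact Hn.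
    rewrite tsub_tapps_ivars in Hv by exact Hn. cbn [tsub] in Hv.
    (* [tmu_app] counts its binders by the arguments, so [length Us'] has to become [length Ns]. *)
    rewrite tsub_tlams, <- Hn in Hv. apply val_in_mu_inv in Hv.
    rewrite <- Hn, tsub_tvunder_tvone by reflexivity. cbn [tsub]. rewrite tsub_tlams. exact Hv.
  - intros t th sg Ns v Us A T Hc HNs Hv.
    apply closure_inv in Hc as (D & G & Us' & A' & T' & Hth & Hsg & Ht & -> & -> & ->).
    pose proof (spine_ty_length HNs) as Hn. rewrite length_spsub in Hn.
    destruct (typing_rule (or_introl Ht)) as [(_ & _ & _ & HT) Hr].
    (* The premise of [c_corec] is also the premise of [v_corec]; the kinding of the result type
       comes from the presupposed kinding of the arrow. *)
    apply kcheck_TArr_inv in HT as (_ & _ & HT).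
    apply (kcheck_isub (isub_ty_isubst_of (isubst_ty_spine Hth HNs))) in HT.
    inv_rule Hr. rewrite tsub_ispine_iupn in * by exact Hn.
    rewrite tsub_tapps_ivars in * by exact Hn.
    constructor; [exact HT | econstructor; eassumption].
  - intros t0 ts th sg w _ IH Us A T Hc HNs _.
    apply closure_inv in Hc as (D & G & Us' & A' & T' & Hth & Hsg & Ht & -> & -> & ->).
    destruct (typing_rule (or_introl Ht)) as [_ Hr]. inv_rule Hr.
    replace (tsub _ (tsub _ T')) with (tsub (isubst_of th) (tsub (ispine [izero]) T')).
    2:{ rewrite tsub_tsub, (iseq_ispine (n := 1)), <- tsub_tsub by reflexivity.
        cbn [map]. rewrite isub_zero. reflexivity. }
    eauto.
  - intros t0 ts th sg N v w _ IHN _ IH Us A T Hc HNs Hv. pose proof Hc as Hc'.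
    apply closure_inv in Hc as (D & G & Us' & A' & T' & Hth & Hsg & Ht & -> & -> & ->).
    destruct (typing_rule (or_introl Ht)) as [_ Hr]. inv_rule Hr.
    cbn [spsub] in *. rewrite itsub_nat in *.
    assert (HN : ihas [] N inat).
    { apply ihas_isuc_inv. inversion HNs. assumption. }
    specialize (IHN _ _ _ Hc' ltac:(repeat constructor; exact HN) Hv).
    rewrite tsub_ispine_iupn in * by reflexivity.
    match goal with Hb : check _ _ _ ts _ |- _ => specialize (IH _ _ _ (or_introl Hb)) end.
    rewrite tsub_tsub in IH.
    (* The branch is typed at [suc u]; putting [N] for [u] there amounts to an environment holding
       [suc N]. *)
    replace (iseq _ (isubst_of (N :: th))) with (isubst_of (rev [isuc N] ++ th)) in IH.
    2:{ extensionality i. unfold iseq. destruct i as [|i]; cbn.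
        - rewrite isub_suc, isub_var. reflexivity.
        - unfold ishift. rewrite isub_var. reflexivity. }
    apply IH.
    + constructor; [exact Hth|]. rewrite itsub_nat. exact HN.
    + cbn [map]. constructor; [|exact IHN].
      pose proof (map_tsub_cshift (n := 1) (Ns := [N]) th G eq_refl) as E. cbn [rev app] in E.
      rewrite E. exact Hsg.
  - intros t th sg Ns v c w _ IHt _ IHc K T Ms Hc.
    apply val_ty_rule in Hc. remember (tnu_app K T Ms) as B eqn:EB.
    inversion Hc as [| | | | | | | | | |? ? ? ? ? D G Us A T' Hth Hsg HNs Hv Hb]; subst.
    match goal with EQ : @eq (ty _) _ _ |- _ => rename EQ into E end.
    apply tapps_inj in E as [[= <- E] <-]; try exact Logic.I.
    pose proof (spine_ty_length HNs) as Hn. rewrite length_spsub in Hn.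
    rewrite tsub_tlams, Hn in E. apply tlams_inj in E as <-.
    pose proof (corec_body Hb) as Hb'.
    (* [v_corec] records only the premise of [c_corec], so the closure stored for [f] must be typed
       afresh. Its type heads the context of the unrolled body, whose presuppositions supply the
       kinding. *)
    destruct (check_presup Hb') as (HD & _ & HG & _). inversion HG as [|? ? HF HG']; subst.
    assert (Hp : presup D [] G (TArr Us A (tapps (tshift (length Us)
                   (TNu (kpis Us) (tlams (length Us) T'))) (ivars (length Us))))).
    { repeat split; [exact HD | constructor | exact HG' | exact HF]. }
    assert (Hf : val_ty (VClo (ECorec t) th sg) (tsub (isubst_of th) (TArr Us A (tapps
                   (tshift (length Us) (TNu (kpis Us) (tlams (length Us) T'))) (ivars (length Us)))))).
    { constructor; [exact (kcheck_closed Hth Hp)|].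
      econstructor; [exact Logic.I | exact Hth | exact Hsg |].
      constructor; [exact Hp | exact (c_corec Hb)]. }
    pose proof (IHt _ _ _ (or_introl Hb') Hth (env_cons Hsg Hf)) as HtT.
    replace (tnu_unfold _ _ _) with (tsub (isubst_of (rev Ns ++ th)) (tvsub (tvunder (length Us)
      (tvone (TNu (kpis Us) (tlams (length Us) T')))) T')).
    2:{ rewrite tsub_tvunder_tvone by exact Hn. cbn [tsub]. unfold tnu_unfold.
        rewrite tsub_tlams, Hn. reflexivity. }
    rewrite <- tsub_ispine_iupn with (n := length Us) by exact Hn.
    eapply IHc; [exact HtT | exact HNs |]. rewrite tsub_ispine_iupn by exact Hn. exact Hv.
Qed.

End SubjectReduction.

Theorem theorem10 (L : index_language) :
  (forall (t : tm L) (th : list (itm L)) (sg : list (val L)) (v : val L)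
          (D : list (ity L)) (G : list (ty L)) (T : ty L),
     eval t th sg v ->
     check D [] G t T \/ synth D [] G t T ->
     isubst_ty [] th D ->
     env_ty sg (map (tsub (isubst_of th)) G) ->
     val_ty v (tsub (isubst_of th) T))
  /\
  (forall (g : tm L) (th : list (itm L)) (sg : list (val L)) (Ns : list (itm L)) (v w : val L)
          (D : list (ity L)) (G : list (ty L)) (Us : list (ity L)) (A T : ty L),
     apply (VClo g th sg) Ns v w ->
     function_value g ->
     check D [] G g (TArr Us A T) ->
     isubst_ty [] th D ->
     env_ty sg (map (tsub (isubst_of th)) G) ->
     spine_ty [] Ns (spsub (isubst_of th) Us) ->
     val_ty v (tsub (isubst_of (rev Ns ++ th)) A) ->
     val_ty w (tsub (isubst_of (rev Ns ++ th)) T))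
  /\
  (forall (c w : val L) (K : kind L) (T : ty L) (Ms : list (itm L)),
     out_nu c w ->
     val_ty c (tnu_app K T Ms) ->
     val_ty w (tnu_unfold K T Ms)).
Proof.
  destruct (evaluation_sound L) as (Heval & Happly & Hout). split; [|split].
  - intros t th sg v D G T Hv. exact (Heval _ _ _ _ Hv D G T).
  - intros g th sg Ns v w D G Us A T Hw Hg Ht Hth Hsg HNs Hv.
    pose proof (spine_ty_length HNs) as Hn. rewrite length_spsub in Hn.
    rewrite <- (tsub_ispine_iupn _ _ Hn) in Hv. rewrite <- (tsub_ispine_iupn _ _ Hn).
    eapply (Happly _ _ _ _ Hw); [|exact HNs | exact Hv].
    (* The separate hypotheses on [g], [th] and [sg] are those of [v_clo], which yields the typed
       closure. *)
    change (val_ty (VClo g th sg) (tsub (isubst_of th) (TArr Us A T))). constructor.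
    + exact (kcheck_closed Hth (check_presup Ht)).
    + econstructor; eassumption.
  - intros c w K T Ms Hw. exact (Hout _ _ Hw K T Ms).
Qed.
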